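(* For a given constant $N \in \mathbb{N}$, for every $\epsilon \in (0,1)$, and for every $n \in \mathbb{N}$, there exists $\delta \in (0,\infty)$ satisfying the following property: let $X$ be an $N$-doubling, proper, geodesically complete $\mathrm{CAT}(0)$ space of $\dim X = n$, and let $F \colon X \to \mathbb{R}^n$ be a Busemann $(n,\delta)$-strainer map. Then $F$ is a $(1+\epsilon)$-bi-Lipschitz homeomorphism.
   Context: $\mathbb{N}$ is the set of positive integers. A metric space is proper if every closed bounded subset is compact. A geodesic metric space is geodesically complete if every geodesic can be extended to a local geodesic defined on $\mathbb{R}$. A metric space is $N$-doubling if every open ball of radius $r$ in it can be covered by at most $N$ open balls of radius $r/2$ (for every $r>0$). $\dim$ is the covering (topological) dimension. A map $f$ of metric spaces is $c$-bi-Lipschitz if $d(f(x_1),f(x_2)) \le c\, d(x_1,x_2)$ and $d(x_1,x_2) \le c\, d(f(x_1),f(x_2))$ for all $x_1,x_2$. The ideal boundary $\partial_{\infty}X$ of a complete $\mathrm{CAT}(0)$ space $X$ is the set of classes of geodesic rays modulo being asymptotic (at bounded distance); $\gamma(\infty)$ is the class of a ray $\gamma$. For $p\in X$, $\xi\in\partial_\infty X$ there is a unique ray $p\xi$ from $p$ in the class $\xi$; $\angle_p(\xi,\eta)$ is the angle at $p$ between $p\xi$ and $p\eta$, and $\angle(\xi,\eta) := \sup_{p\in X}\angle_p(\xi,\eta)$. The Busemann function along a ray $\gamma$ is $b_\gamma(x):=\lim_{t\to\infty}(d_X(x,\gamma(t))-t)$. Let $\delta\in(0,\infty)$. Points $\xi,\eta\in\partial_\infty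 X$ are opposite $\delta$-spherical points if $\angle(\xi,\zeta)+\angle(\zeta,\eta)<\pi+\delta$ for every $\zeta\in\partial_\infty X$. An $m$-tuple $(\xi_1,\dots,\xi_m)$ in $\partial_\infty X$ is an $(m,\delta)$-strainer at infinity if there is another $m$-tuple $(\eta_1,\dots,\eta_m)$ in $\partial_\infty X$ such that (1) $\xi_j$ and $\eta_j$ are opposite $\delta$-spherical points for all $j$; (2) $\angle(\xi_j,\xi_k)$, $\angle(\eta_j,\eta_k)$ and $\angle(\xi_j,\eta_k)$ are smaller than $\pi/2+\delta$ for all distinct $j,k$. For rays $\gamma_1,\dots,\gamma_m$ in $X$, the map $F=(b_{\gamma_1},\dots,b_{\gamma_m})\colon X\to\mathbb{R}^m$ is a Busemann $(m,\delta)$-strainer map if $(\gamma_1(\infty),\dots,\gamma_m(\infty))$ is an $(m,\delta)$-strainer at infinity. *)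

(* Defs.v *)
From HB Require Import structures.
From mathcomp Require Import all_boot all_order all_algebra.
From mathcomp Require Import all_classical all_reals all_analysis.

Set Implicit Arguments.
Unset Strict Implicit.
Unset Printing Implicit Defensive.

Import Order.TTheory GRing.Theory Num.Theory.
Import numFieldNormedType.Exports.

Local Open Scope classical_set_scope.
Local Open Scope ring_scope.

(* The library norm on row vectors is the sup norm, whereas R^n carries the
   Euclidean metric here; the two metrics induce the same topology. *)
Definition eucl_dist (R : realType) (n : nat) (u v : 'rV[R]_n) : R :=
  Num.sqrt (\sum_(i < n) (u ord0 i - v ord0 i) ^+ 2).

Definition bilipschitz (R : realType) (S T : Type) (dS : S -> S -> R)
    (dT : T -> T -> R) (c : R) (f : S -> T) : Prop :=
  forall x y, dT (f x) (f y) <= c * dS x y /\ dS x y <= c * dT (f x) (f y).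

Definition homeomorphism (S T : topologicalType) (f : S -> T) : Prop :=
  exists g : T -> S, [/\ continuous f, continuous g, cancel f g & cancel g f].

Section CoveringDimension.
Variable X : topologicalType.
Implicit Types U V : set (set X).

Definition open_cover U : Prop :=
  (forall A, U A -> open A) /\ \bigcup_(A in U) A = setT.

Definition refines V U : Prop :=
  forall B, V B -> exists2 A, U A & B `<=` A.

Definition multiplicity_le V (k : nat) : Prop :=
  forall x, ([set B | V B /\ B x] #<= (`I_k))%card.

Definition has_refinements (k : nat) : Prop :=
  forall U, finite_set U -> open_cover U ->
    exists V, [/\ open_cover V, refines V U & multiplicity_le V k].

(* Covers are finite, as in the definition of Cech and Lebesgue; for metrizable
   spaces arbitrary open covers give the same dimension.
   dim X <= n iff refinements of multiplicity at most n + 1 exist;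
   multiplicity 0 is possible only for the empty space, of dimension -1. *)
Definition covering_dim (n : nat) : Prop :=
  has_refinements n.+1 /\ ~ has_refinements n.

End CoveringDimension.

Section MetricSpace.
Variables (R : realType) (X : metricType R).
Local Notation d := (@mdist R X).

Definition proper_space : Prop :=
  forall A : set X, closed A -> (exists p r, A `<=` ball p r) -> compact A.

Definition doubling (N : nat) : Prop :=
  forall (p : X) (r : R), 0 < r ->
    exists s : seq X, (size s <= N)%N /\
      ball p r `<=` \bigcup_(q in [set` s]) ball q (r / 2).

(* Curves are total functions on R; only their values on I matter. *)
Definition geodesic_on (I : set R) (c : R -> X) : Prop :=
  forall s t, I s -> I t -> d (c s) (c t) = `|s - t|.

Definition local_geodesic (c : R -> X) : Prop :=
  forall t, exists2 e : R, 0 < e & geodesic_on (ball t e) c.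

Definition geodesically_complete : Prop :=
  forall (a b : R) (c : R -> X), a <= b -> geodesic_on `[a, b] c ->
    exists2 c' : R -> X, local_geodesic c' & {in `[a, b], c' =1 c}.

Definition is_segment (p q : X) (S : set X) : Prop :=
  exists c : R -> X, [/\ geodesic_on `[0, d p q] c, c 0 = p, c (d p q) = q &
    S = c @` `[0, d p q]].

Definition geodesic_space : Prop := forall p q, exists S, is_segment p q S.

(* xb is the point corresponding to a point x of the side [v i, v (i + 1)] on
   the side [w i, w (i + 1)] of the comparison triangle w in the plane. *)
Definition comparison_point (v : 'Z_3 -> X) (w : 'Z_3 -> 'rV[R]_2) (i : 'Z_3)
    (x : X) (xb : 'rV[R]_2) : Prop :=
  (exists2 t : R, 0 <= t <= 1 & xb = (1 - t) *: w i + t *: w (i + 1)) /\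
  eucl_dist (w i) xb = d (v i) x.

(* The vertices of a triangle are indexed modulo 3, and its side S i joins
   v i to v (i + 1). *)
Definition cat0 : Prop :=
  geodesic_space /\
  forall (v : 'Z_3 -> X) (S : 'Z_3 -> set X) (w : 'Z_3 -> 'rV[R]_2),
    (forall i, is_segment (v i) (v (i + 1)) (S i)) ->
    (forall i j, eucl_dist (w i) (w j) = d (v i) (v j)) ->
    forall (i j : 'Z_3) (x y : X) (xb yb : 'rV[R]_2),
      S i x -> S j y ->
      comparison_point v w i x xb -> comparison_point v w j y yb ->
      d x y <= eucl_dist xb yb.

(* Angle at p in a Euclidean triangle with side lengths d p x, d p y, d x y. *)
Definition comparison_angle (p x y : X) : R :=
  acos ((d p x ^+ 2 + d p y ^+ 2 - d x y ^+ 2) / (2 * d p x * d p y)).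

(* Alexandrov angle of two geodesics issuing from the same point c 0 = c' 0. *)
Definition alexandrov_angle (c c' : R -> X) : R :=
  fine (limf_esup
    (fun st : R * R => (comparison_angle (c 0) (c st.1) (c' st.2))%:E)
    (filter_prod 0^'+ 0^'+)).

Definition is_ray (c : R -> X) : Prop := geodesic_on `[0, +oo[ c.

Definition asymptotic (c c' : R -> X) : Prop :=
  exists K : R, forall t, 0 <= t -> d (c t) (c' t) <= K.

Definition ray_class (c : R -> X) : set (R -> X) :=
  [set c' | is_ray c' /\ asymptotic c c'].

Definition ideal_boundary : set (set (R -> X)) :=
  [set ray_class c | c in is_ray].

(* The ray from p in the class xi, unique up to its values at negative times;
   the constant curve is a dummy default. *)
Definition ray_from (p : X) (xi : set (R -> X)) : R -> X :=
  xget (fun=> p) [set c | xi c /\ c 0 = p].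

Definition angle_at (p : X) (xi eta : set (R -> X)) : R :=
  alexandrov_angle (ray_from p xi) (ray_from p eta).

Definition angle (xi eta : set (R -> X)) : R :=
  sup [set angle_at p xi eta | p in setT].

Definition busemann (c : R -> X) (x : X) : R :=
  lim ((d x (c t) - t) @[t --> +oo]).

Definition opposite_spherical (delta : R) (xi eta : set (R -> X)) : Prop :=
  forall zeta, ideal_boundary zeta ->
    angle xi zeta + angle zeta eta < pi + delta.

Definition strainer_at_infinity (m : nat) (delta : R)
    (xi : 'I_m -> set (R -> X)) : Prop :=
  (forall j, ideal_boundary (xi j)) /\
  exists eta : 'I_m -> set (R -> X),
    [/\ forall j, ideal_boundary (eta j),
        forall j, opposite_spherical delta (xi j) (eta j) &
        forall j k, j != k ->
          [/\ angle (xi j) (xi k) < pi / 2 + delta,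
              angle (eta j) (eta k) < pi / 2 + delta &
              angle (xi j) (eta k) < pi / 2 + delta]].

Definition busemann_strainer_map (m : nat) (delta : R)
    (F : X -> 'rV[R]_m) : Prop :=
  exists gamma : 'I_m -> R -> X,
    [/\ forall j, is_ray (gamma j),
        strainer_at_infinity delta (fun j => ray_class (gamma j)) &
        forall x, F x = \row_j busemann (gamma j) x].

End MetricSpace.

(* Main.v *)
Require Import Defs.
From mathcomp Require Import all_boot all_order all_algebra all_fingroup.
From mathcomp Require Import all_classical all_reals all_analysis.
From mathcomp Require Import ring lra zify.
Set Implicit Arguments.
Unset Strict Implicit.
Unset Printing Implicit Defensive.
Import Order.TTheory GRing.Theory Num.Theory.
Import numFieldNormedType.Exports.
Local Open Scope classical_set_scope.
Local Open Scope ring_scope.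

(** Why the theorem is true. Let b_j and b'_j be the Busemann functions of
    rays in the classes xi_j and eta_j of the strainer. The first variation
    formula and the convexity of Busemann functions show that along a ray of
    class zeta the function b_j has slope at most - cos (angle xi_j zeta)
    ([busemann_slope]). Every geodesic segment extends to a ray, so the
    hypothesis that xi_j and eta_j are opposite delta-spherical implies
    that b_j + b'_j is delta-Lipschitz ([opposite_lipschitz]); the conditions
    on the other angles say that b_k hardly changes along the rays to xi_j and
    eta_j for j != k. Walking along rays to the xi_j and eta_j therefore moves
    the coordinates of F one at a time, up to O(delta).

    Upper bound. The CAT(0) inequality passes to the limit at infinity: if q'
    is reached from q by walking a time t to xi_j, then
      d(y,q')^2 <= d(y,q)^2 + 2 t (b_j y - b_j q) + t^2
    ([busemann_stewart]). Walking from x through all the coordinate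
    differences between x and y lowers the squared distance to y by
    |F x - F y|^2 up to O(delta) d(x,y)^2, and the outcome is nonnegative
    ([coords_upper]).

    Surjectivity. The same walk towards a prescribed value z multiplies the
    error by O(delta) ([coords_improve]), so the minimum of the error on a
    large compact ball is 0.

    Lower bound; this is where dim X = n enters. Suppose that |F x - F y| is
    noticeably smaller than d(x,y), let zeta be the end of a ray from x
    through y and let al_j be the mean slope of b_j between x and y. As b_j
    and b'_j are convex with a delta-Lipschitz sum, b_j has slope al_j up to
    O(delta) along every ray to zeta ([line_slope], [slope_transfer]). A
    symmetry in the inequality above ([slope_symmetric]) turns this into a
    bound for the Busemann function of zeta along rays to xi_j, whose slope is
    al_j up to O(sqrt delta) ([move_back]). The n + 1 walks to the xi_j and to
    zeta thus change the n + 1 functions by a matrix close to that with blocks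
    1, - al, - al^T, 1, whose determinant 1 - |al|^2 is bounded away from 0.
    After inverting this matrix, composing the walks gives a Lipschitz map
    from the cube [0,1]^(n+1) to X which n + 1 functions on X bring back to
    within 1/4 of the identity ([dimension_bound]). Lebesgue's covering theorem
    forbids this when X has dimension at most n ([cube_obstruction]); it rests
    on a cubical form of Sperner's lemma ([kuhn_cubical_sperner]). *)

(** * Sperner's lemma for the cube *)

Section Sperner.

(** Over F_2 the 0-1 matrix that marks the labels has determinant 1 when l is a
    bijection from [0, N) onto [0, N), and 0 otherwise. With this encoding the
    usual count of fully labelled facets modulo 2 is a Laplace expansion. *)
Definition rainbow (N : nat) (l : nat -> nat) : 'F_2 :=
  \det (\matrix_(k < N, j < N) (l k == j)%:R : 'M['F_2]_N).

Lemma addF2 (x : 'F_2) : x + x = 0.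
Proof. by apply: addrr_pchar2; rewrite pchar_Fp. Qed.

(** The doors argument of Sperner's lemma modulo 2: a simplex with labels
    0, ..., N has an odd number of facets labelled 0, ..., N - 1 if and only if
    it carries all labels. *)
Lemma rainbowS N l : (forall k, (k <= N)%N -> (l k <= N)%N) ->
  rainbow N.+1 l = \sum_(k < N.+1) rainbow N (l \o bump k).
Proof.
move=> lN; rewrite /rainbow.
set M := (X in \det X = _).
(* Multiplication by U replaces the last column by the sum of all columns,
   which is constantly 1 since each vertex has exactly one label. *)
pose U : 'M['F_2]_N.+1 := \matrix_(i, j) ((i == j) || (j == ord_max))%:R.
have detU : \det U = 1.
  rewrite -det_tr det_trig; last first.
    apply/is_trig_mxP => i j ij; rewrite !mxE.
    have -> : (j == i) = false by apply/negbTE; rewrite neq_ltn ij orbT.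
    case: eqP => //= imax.
    by move: ij; rewrite imax /= ltnNge -ltnS ltn_ord.
  by rewrite big1 // => i _; rewrite !mxE eqxx.
have MU (k j : 'I_N.+1) :
    (M *m U) k j = if j == ord_max then 1 else (l k == j)%:R.
  rewrite mxE; have lk : (l k < N.+1)%N by rewrite ltnS lN // -ltnS.
  rewrite (bigD1 (Ordinal lk)) //= !mxE eqxx mul1r big1 ?addr0.
    by case: (j == ord_max); rewrite ?orbT ?orbF.
  move=> i /eqP ni; rewrite !mxE; case: eqP => [e|]; last by rewrite mul0r.
  by case: ni; apply: val_inj; rewrite /= e.
have -> : \det M = \det (M *m U) by rewrite det_mulmx detU mulr1.
rewrite (expand_det_col _ ord_max); apply: eq_bigr => k _.
rewrite MU eqxx mul1r /cofactor.
have -> : (-1) ^+ (k + ord_max (n' := N)) = 1 :> 'F_2.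
  by rewrite (_ : -1 = 1 :> 'F_2) ?expr1n //; apply: val_inj.
rewrite mul1r; congr (\det _); apply/matrixP => i j.
rewrite [LHS]mxE [LHS]mxE MU mxE.
by rewrite (negbTE (_ : lift ord_max j != ord_max)) ?lift_max // eq_sym neq_lift.
Qed.

Lemma rainbow_missing N l (j : nat) : (j < N)%N ->
  (forall k, (k < N)%N -> l k != j) -> rainbow N l = 0.
Proof.
move=> jN lj; rewrite /rainbow (expand_det_col _ (Ordinal jN)) big1 // => i _.
by rewrite mxE /= (negbTE (lj _ _)) // mul0r.
Qed.

(** Two equal labels give two equal rows. *)
Lemma rainbow_inj N l : rainbow N l != 0 ->
  forall i j, (i < N)%N -> (j < N)%N -> l i = l j -> i = j.
Proof.
move=> l0 i j iN jN lij; apply/eqP/negPn/negP => ij.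
move/eqP: l0; apply; rewrite /rainbow.
apply: (@determinant_alternate _ _ _ (Ordinal iN) (Ordinal jN)) => [|k].
  by apply: contra ij => /eqP [->].
by rewrite !mxE /= lij.
Qed.

(** The simplex of Kuhn's triangulation in the cell at u given by p is the
    chain from u to u + (1, ..., 1) in which coordinate i is increased at time
    p i. *)
Definition kuhn_vertex N (u : 'I_N -> nat) (p : 'S_N) (k : nat) : 'I_N -> nat :=
  fun i => (u i + (p i < k))%N.

Definition kuhn_sum N m (L : ('I_N -> nat) -> nat) : 'F_2 :=
  \sum_(v : {ffun 'I_N -> 'I_m.+1}) \sum_(p : 'S_N)
    rainbow N.+1 (fun k => L (kuhn_vertex (fun i => v i) p k)).

(** Multiplication by an odd permutation matches the odd permutations with the
    even ones, and the two equal halves cancel modulo 2. *)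
Lemma sum_odd_cancel N (f : 'S_N -> 'F_2) (t : 'S_N) :
  odd_perm t -> (forall p, f (p * t)%g = f p) -> \sum_p f p = 0.
Proof.
move=> ot ft; rewrite (bigID (fun p : 'S_N => odd_perm p)) /=.
rewrite (reindex_inj (mulIg t)) /=.
rewrite [X in X + _](_ : _ = \sum_(p : 'S_N | ~~ odd_perm p) f p) ?addF2 //.
apply: eq_big => [p|p _]; last exact: ft.
by rewrite odd_permM ot addbT.
Qed.

Lemma rainbow_eq N l1 l2 : (forall k, (k < N)%N -> l1 k = l2 k) ->
  rainbow N l1 = rainbow N l2.
Proof.
by move=> e; congr (\det _); apply/matrixP => i j; rewrite !mxE e.
Qed.

(** The facet opposite to an inner vertex k is shared with exactly one other
    simplex of the same cell, the one that exchanges the increments made at the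
    times k - 1 and k. *)
Lemma inner_facets_cancel N (L : ('I_N.+1 -> nat) -> nat) u (k : 'I_N.+2) :
  k != ord0 -> k != ord_max ->
  \sum_(p : 'S_N.+1)
    rainbow N.+1 ((fun j => L (kuhn_vertex u p j)) \o bump k) = 0.
Proof.
move=> k0 kN.
have kpos : (0 < k)%N by rewrite lt0n; apply: contra k0 => /eqP k0; apply/eqP/val_inj.
have kltN : (k < N.+1)%N.
  have := ltn_ord k; rewrite ltnS leq_eqVlt => /orP[/eqP e|//].
  by move/eqP: kN; case; apply: val_inj.
have k1ltN : (k.-1 < N.+1)%N by lia.
pose a := Ordinal k1ltN; pose b := Ordinal kltN.
apply: (@sum_odd_cancel _ _ (tperm a b)).
  by rewrite odd_tperm; apply/eqP => /(congr1 val) /=; lia.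
move=> p; apply: rainbow_eq => j _ /=; congr L; apply/funext => i.
rewrite /kuhn_vertex permM; congr (_ + _)%N; congr (nat_of_bool _).
have := neq_bump k j; set j' := bump k j => jk.
case: tpermP => [->|->|//] /=; lia.
Qed.

Definition facet_label N (L : ('I_N.+1 -> nat) -> nat) (u : 'I_N.+1 -> nat)
  (p : 'S_N.+1) : 'F_2 := rainbow N.+1 (fun j => L (kuhn_vertex u p j)).

Definition bump_at N (i0 : 'I_N) (u : 'I_N -> nat) : 'I_N -> nat :=
  fun i => (u i + (i == i0))%N.

Definition rot_perm N : 'S_N.+1 := perm (@ord_pred_inj N.+1).

(** The facet opposite to the first vertex is the facet opposite to the last
    vertex for a simplex of the neighbouring cell, with the order of increments
    rotated by one step. *)
Lemma first_facet N (L : ('I_N.+1 -> nat) -> nat) u (p : 'S_N.+1) :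
  rainbow N.+1 ((fun j => L (kuhn_vertex u p j)) \o bump 0) =
  facet_label L (bump_at ((p * rot_perm N)^-1%g ord_max) u) (p * rot_perm N)%g.
Proof.
apply: rainbow_eq => j jN /=; congr L; apply/funext => i.
rewrite /kuhn_vertex /bump_at -addnA; congr (_ + _)%N.
rewrite -(inj_eq (@perm_inj _ (p * rot_perm N)%g)) permKV permM permE /bump /=.
rewrite -val_eqE /=.
have pN := ltn_ord (p i).
case: (posnP (p i)) => [->|p0].
  by rewrite add0n modn_small //= eqxx; lia.
have -> : ((p i + N.+1).-1 = (p i).-1 + N.+1)%N by lia.
rewrite modnDr modn_small; last by lia.
lia.
Qed.

(** The cyclic shift makes the reindexing a bijection; it is a true step of
    the grid except at the last cell. *)
Definition cshift N m (i0 : 'I_N) (v : {ffun 'I_N -> 'I_m.+1}) :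
  {ffun 'I_N -> 'I_m.+1} := [ffun i => if i == i0 then ordS (v i) else v i].

Lemma cshift_inj N m i0 : injective (@cshift N m i0).
Proof.
move=> v w /ffunP e; apply/ffunP => i; have := e i; rewrite !ffunE.
by case: eqP => // _; apply: ordS_inj.
Qed.

Lemma ordS0 m (i : 'I_m.+1) : (ordS i == ord0) = (i == ord_max).
Proof.
rewrite -!val_eqE /=; have := ltn_ord i; rewrite ltnS leq_eqVlt.
case/orP => [/eqP ->|im]; first by rewrite modnn !eqxx.
by rewrite modn_small ?ltnS // (ltn_eqF im).
Qed.

Lemma ordS_val m (i : 'I_m.+1) : i != ord_max -> ordS i = i.+1 :> nat.
Proof.
rewrite -val_eqE /= => im; rewrite modn_small // ltnS.
by rewrite ltn_neqAle im -ltnS ltn_ord.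
Qed.

(** Facets shared by neighbouring cells in direction i0 cancel in pairs; only
    the two boundary layers survive. *)
Lemma telescope_coordinate N m (i0 : 'I_N) (G : ('I_N -> nat) -> 'F_2) :
  \sum_(v : {ffun 'I_N -> 'I_m.+1}) G (bump_at i0 (fun i => v i)) +
  \sum_(v : {ffun 'I_N -> 'I_m.+1}) G (fun i => v i) =
  \sum_(v : {ffun 'I_N -> 'I_m.+1} | v i0 == ord_max)
     G (bump_at i0 (fun i => v i)) +
  \sum_(v : {ffun 'I_N -> 'I_m.+1} | v i0 == ord0) G (fun i => v i).
Proof.
rewrite (bigID (fun v : {ffun 'I_N -> 'I_m.+1} => v i0 == ord_max)) /=.
rewrite [X in _ + X](bigID (fun v : {ffun 'I_N -> 'I_m.+1} => v i0 == ord0)) /=.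
rewrite -!addrA; congr (_ + _); rewrite addrCA -[RHS]addr0; congr (_ + _).
rewrite [X in _ + X](reindex_inj (@cshift_inj N m i0)) /=.
rewrite -[RHS](addF2 (\sum_(v : {ffun 'I_N -> 'I_m.+1} | v i0 != ord_max)
   G (bump_at i0 (fun i => v i)))); congr (_ + _).
apply: eq_big => [v|v]; rewrite ffunE eqxx ordS0 // => vm.
congr G; apply/funext => i; rewrite /bump_at ffunE.
by case: eqP => [->|_]; rewrite ?addn0 // ordS_val // addn1.
Qed.

Definition extend_face N m (u : 'I_N -> nat) : 'I_N.+1 -> nat :=
  fun i => if unlift ord_max i is Some j then u j else m.

(** Reindexing by the permutations fixing the last coordinate identifies the
    triangulation of the face with Kuhn's triangulation one dimension lower. *)
Lemma lift_max_perm_bij N :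
  {on [pred p : 'S_N.+1 | p ord_max == ord_max],
     bijective (lift_perm ord_max ord_max)}.
Proof.
pose ulsf i (s : 'S_N.+1) k := odflt k (unlift (s i) (s (lift i k))).
have ulsfK i (s : 'S_N.+1) k : lift (s i) (ulsf i s k) = s (lift i k).
  rewrite /ulsf; have := neq_lift i k.
  by rewrite -(can_eq (permK s)) => /unlift_some[] ? ? ->.
have inj_ulsf : injective (ulsf ord_max _).
  move=> s; apply: can_inj (ulsf (s ord_max) s^-1%g) _ => k'.
  by rewrite {1}/ulsf ulsfK !permK liftK.
exists (fun s => perm (inj_ulsf s)) => [s _ | s].
  by apply/permP=> k'; rewrite permE /ulsf lift_perm_lift lift_perm_id liftK.
rewrite inE => /(s _ =P _) si0; apply/permP=> k.
case: (unliftP ord_max k) => [k'|] ->; rewrite ?lift_perm_id //.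
rewrite lift_perm_lift permE; by have := ulsfK ord_max s k'; rewrite si0.
Qed.

Definition extend_ffun N m (v : {ffun 'I_N -> 'I_m.+1}) :
    {ffun 'I_N.+1 -> 'I_m.+1} :=
  [ffun i => if unlift ord_max i is Some j then v j else ord_max].

Lemma extend_ffun_bij N m :
  {on [pred v : {ffun 'I_N.+1 -> 'I_m.+1} | v ord_max == ord_max],
     bijective (@extend_ffun N m)}.
Proof.
exists (fun v => [ffun j => v (lift ord_max j)]) => [v _|v].
  by apply/ffunP => j; rewrite !ffunE liftK.
rewrite inE => /eqP vm; apply/ffunP => i; rewrite ffunE.
by case: unliftP => [j ->|->]; rewrite ?ffunE ?vm.
Qed.

(** All facets inside the cube cancel. The boundary conditions make a facet
    with labels 0, ..., N impossible on every face of the cube except the upper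
    face in the last direction, which is the same problem one dimension lower. *)
Lemma kuhn_sumS N m (L : ('I_N.+1 -> nat) -> nat) :
  (forall u, (forall i, (u i <= m.+1)%N) ->
     [/\ (L u <= N.+1)%N, forall i, u i = 0%N -> L u <> i &
         forall i, u i = m.+1 -> (L u <= i)%N]) ->
  kuhn_sum m L = kuhn_sum m (fun u => L (extend_face m.+1 u)).
Proof.
move=> HL.
have bnd (v : {ffun 'I_N.+1 -> 'I_m.+1}) (p : 'S_N.+1) k i :
    (kuhn_vertex (fun i => v i) p k i <= m.+1)%N.
  by rewrite /kuhn_vertex; have := ltn_ord (v i); case: (ltnP (p i) k) => _ /=; lia.
have bnd' (v : {ffun 'I_N.+1 -> 'I_m.+1}) (p : 'S_N.+1) k i :
   (k <= N)%N ->
   (kuhn_vertex (bump_at (p^-1%g ord_max) (fun i => v i)) p k i <= m.+1)%N.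
  move=> kN; rewrite /kuhn_vertex /bump_at; have := ltn_ord (v i).
  rewrite -(inj_eq (@perm_inj _ p)) permKV -val_eqE /=.
  by case: (ltnP (p i) k) => ?; case: eqP => ? /=; lia.
have bfix (u : 'I_N.+1 -> nat) (p : 'S_N.+1) k : (k <= N)%N ->
   kuhn_vertex u p k (p^-1%g ord_max) = u (p^-1%g ord_max).
  by move=> kN; rewrite /kuhn_vertex permKV /= ltnNge kN addn0.
transitivity (\sum_(p : 'S_N.+1) (
    \sum_(v : {ffun 'I_N.+1 -> 'I_m.+1})
      facet_label L (bump_at (p^-1%g ord_max) (fun i => v i)) p +
    \sum_(v : {ffun 'I_N.+1 -> 'I_m.+1}) facet_label L (fun i => v i) p)).
  rewrite big_split /= [X in X + _]exchange_big [X in _ + X]exchange_big /=.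
  rewrite -big_split /= /kuhn_sum; apply: eq_bigr => v _.
  rewrite (eq_bigr (fun p : 'S_N.+1 => \sum_(k < N.+2) rainbow N.+1
    ((fun j => L (kuhn_vertex (fun i => v i) p j)) \o bump k))); last first.
    by move=> p _; apply: rainbowS => k _; case: (HL _ (bnd v p k)).
  rewrite exchange_big /= (bigD1 ord0) //= (bigD1 ord_max) //= addrA.
  rewrite [X in _ + X]big1 ?addr0; last first.
    by move=> k /andP[k0 kN]; apply: inner_facets_cancel.
  congr (_ + _).
    under eq_bigr => p _ do rewrite first_facet.
    by rewrite [RHS](reindex_inj (mulIg (rot_perm N))).
  apply: eq_bigr => p _; apply: rainbow_eq => j jN /=.
  by rewrite /bump leqNgt jN.
under eq_bigr => p _.
  rewrite (@telescope_coordinate _ _ _ (fun u => facet_label L u p)).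
  rewrite [X in _ + X]big1 ?addr0; last first.
    (* Label i does not occur on the lower face in direction i. *)
    move=> v /eqP v0; apply: (@rainbow_missing _ _ (p^-1%g ord_max)) => // k kN.
    have [_ H _] := HL _ (bnd v p k).
    by apply/eqP/H; rewrite bfix // v0.
  over.
rewrite (bigID (fun p : 'S_N.+1 => p ord_max == ord_max)) /=.
rewrite [X in _ + X]big1 ?addr0; last first.
  (* On the upper face in a direction i < N all labels are at most i, so that
     label N is missing. *)
  move=> p pmax; rewrite big1 // => v /eqP vm.
  apply: (@rainbow_missing _ _ N) => // k kN.
  have := HL _ (fun i => @bnd' v p k i kN).
  move=> [_ _ /(_ (p^-1%g ord_max))].
  rewrite bfix // {1}/bump_at eqxx vm /= addn1 => /(_ erefl) le.
  apply/negbT/ltn_eqF/(leq_ltn_trans le).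
  rewrite ltn_neqAle -ltnS ltn_ord andbT; apply: contra pmax => /eqP e.
  by rewrite -[X in p X](_ : p^-1%g ord_max = _) ?permKV //; apply: val_inj.
rewrite (reindex _ (@lift_max_perm_bij N)) /= /kuhn_sum exchange_big /=.
apply: eq_big => [p|p _]; first by rewrite lift_perm_id eqxx.
have -> : (lift_perm ord_max ord_max p)^-1%g ord_max = ord_max.
  by apply: (@perm_inj _ (lift_perm ord_max ord_max p)); rewrite permKV lift_perm_id.
rewrite (reindex _ (@extend_ffun_bij N m)) /=.
apply: eq_big => [v|v _]; first by rewrite ffunE unlift_none eqxx.
apply: rainbow_eq => k kN; congr L; apply/funext => i.
rewrite /kuhn_vertex /bump_at /extend_face ffunE.
case: unliftP => [j ->|->].
  by rewrite lift_perm_lift lift_max [_ == ord_max]eq_sym (negbTE (neq_lift _ _)) addn0.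
by rewrite lift_perm_id eqxx /= addn1 ltnNge -ltnS kN addn0.
Qed.

Lemma kuhn_sum1 N m (L : ('I_N -> nat) -> nat) :
  (forall u, (forall i, (u i <= m.+1)%N) ->
     [/\ (L u <= N)%N, forall i, u i = 0%N -> L u <> i &
         forall i, u i = m.+1 -> (L u <= i)%N]) ->
  kuhn_sum m L = 1.
Proof.
elim: N L => [|N IH] L HL.
  rewrite /kuhn_sum (big_pred1 [ffun i => ord0]) => [|v]; last first.
    by rewrite /=; apply/esym/eqP/ffunP => -[].
  rewrite (big_pred1 1%g) => [|p]; last first.
    by rewrite /=; apply/esym/eqP/permP => -[].
  rewrite /rainbow det_mx11 mxE.
  have L0 u : L u = 0%N.
    by have [|+ _ _] := HL u; [case | rewrite leqn0 => /eqP].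
  by rewrite L0.
rewrite kuhn_sumS //; apply: IH => u um.
have um' i : (extend_face m.+1 u i <= m.+1)%N.
  by rewrite /extend_face; case: unlift.
have [L1 L2 L3] := HL _ um'.
have ul (i : 'I_N) : extend_face m.+1 u (lift ord_max i) = u i.
  by rewrite /extend_face liftK.
split.
- by apply: (L3 ord_max); rewrite /extend_face unlift_none.
- by move=> i ui; have := L2 (lift ord_max i); rewrite ul lift_max; apply.
- by move=> i ui; have := L3 (lift ord_max i); rewrite ul lift_max; apply.
Qed.

(** The total number of fully labelled simplices is odd, hence not zero. *)
Lemma kuhn_cubical_sperner N m (L : ('I_N -> nat) -> nat) :
  (forall u, (forall i, (u i <= m.+1)%N) ->
     [/\ (L u <= N)%N, forall i, u i = 0%N -> L u <> i &
         forall i, u i = m.+1 -> (L u <= i)%N]) ->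
  exists (v : {ffun 'I_N -> 'I_m.+1}) (p : 'S_N),
    forall j k, (j <= N)%N -> (k <= N)%N ->
      L (kuhn_vertex (fun i => v i) p j) = L (kuhn_vertex (fun i => v i) p k) ->
      j = k.
Proof.
move=> /kuhn_sum1 S1; apply: contrapT => noex.
have : kuhn_sum m L = 0.
  rewrite /kuhn_sum big1 // => v _; rewrite big1 // => p _.
  apply/eqP/negPn/negP => /rainbow_inj r.
  by apply: noex; exists v, p => j k jN kN; apply: r.
by rewrite S1 => /eqP; rewrite oner_eq0.
Qed.

End Sperner.
(** * Essential maps of cubes and covering dimension *)

Section Dimension.
Variables (R : realType) (X : metricType R).
Local Notation d := (@mdist R X).

Lemma compact_seq_cluster (K : set X) (u : nat -> X) :
  compact K -> (forall n, K (u n)) ->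
  exists2 p, K p & forall r n0, 0 < r -> exists2 n, (n0 <= n)%N & d p (u n) < r.
Proof.
move=> cK uK; have [|p [Kp clp]] := cK (u @ \oo) _.
  by exists 0%N => // n _; exact: uK.
exists p => // r n0 r0.
have : (u @ \oo) [set u n | n in [set n | (n0 <= n)%N]].
  by exists n0 => // n /= n0n; exists n.
move=> /clp /(_ (nbhsx_ballx p r r0)) [_ [[n n0n <-]]].
by rewrite ballEmdist /= => dp; exists n.
Qed.

Lemma lebesgue_number (K : set X) (V : set (set X)) :
  compact K -> open_cover V ->
  exists2 lam : R, 0 < lam &
    forall x, K x -> exists2 B, V B & forall y, d x y < lam -> B y.
Proof.
move=> cK [Vo Vc]; apply: contrapT => nolam.
have bad n : exists x, K x /\
    forall B, V B -> ~ forall y, d x y < n.+1%:R^-1 -> B y.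
  apply: contrapT => H; apply: nolam; exists n.+1%:R^-1 => // x Kx.
  apply: contrapT => H2; apply: H; exists x; split => // B VB H3.
  by apply: H2; exists B.
have [u Hu] := choice bad.
have [p Kp clp] := compact_seq_cluster cK (fun n => (Hu n).1).
have [B VB Bp] : (\bigcup_(A in V) A) p by rewrite Vc.
have := open_nbhs_nbhs (conj (Vo B VB) Bp).
move=> /nbhs_ballP [r /= r0 rB].
have r20 : 0 < r / 2 by rewrite divr_gt0.
have [n1 _ Hn1] := near_infty_natSinv_lt (PosNum r20).
have [n n1n pun] := clp (r / 2) n1 r20.
have := (Hu n).2 B VB; apply => y uny.
apply: rB; rewrite ballEmdist /=.
apply: (le_lt_trans (metric_triangle p (u n) y)).
by rewrite [r]splitr ltrD // (lt_trans uny) //; exact: Hn1.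
Qed.

(** Lebesgue's covering theorem in the form used below: a space in which finite
    open covers have refinements of multiplicity N admits no map s from the
    N-cube with a left inverse up to an error 1/4. A refinement of the cover by
    the sets [US] colours the vertices of a fine grid so that no colour occurs
    on two opposite faces; Sperner's lemma gives a small simplex with N + 1
    different colours, and each of them contains the image of its first
    vertex. *)
Lemma cube_obstruction N (K : set X) (s : ('I_N -> R) -> X) (H : 'I_N -> X -> R) :
  compact K ->
  (forall i, continuous (H i)) ->
  (forall t, (forall i, 0 <= t i <= 1) -> K (s t)) ->
  (forall t u, (forall i, 0 <= t i <= 1) -> (forall i, 0 <= u i <= 1) ->
     d (s t) (s u) <= \sum_i `|t i - u i|) ->
  (forall t i, (forall i, 0 <= t i <= 1) -> `|H i (s t) - t i| <= 1 / 4) ->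
  ~ has_refinements X N.
Proof.
move=> cK Hcont sK slip Hs refin.
(* No US S meets the images of two opposite faces of the cube. *)
pose US (S : {set 'I_N}) : set X :=
  [set x | forall i, if i \in S then H i x < 3 / 4 else 1 / 4 < H i x].
have [|V [Vc VU Vm]] := refin (range US) (finite_image _ finite_finset).
  split.
    move=> _ [S _ <-]; rewrite openE => x /= xS.
    rewrite /interior; apply: filter_forall => i.
    have Hi := Hcont i x; have := xS i; case: ifP => _ lt.
      by apply: (Hi [set z | z < 3 / 4]); apply: open_nbhs_nbhs; split; [exact: open_lt|].
    by apply: (Hi [set z | 1 / 4 < z]); apply: open_nbhs_nbhs; split; [exact: open_gt|].
  rewrite -subTset => x _.
  pose S := finset (fun i => H i x < 3 / 4); exists (US S); first by exists S.
  move=> i; rewrite finset.in_set; case: ltP => // h; apply: lt_le_trans h; lra.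
have [lam lam0 Hlam] := lebesgue_number cK Vc.
pose m := Num.Def.archi_bound (N%:R / lam).
have Nm : N%:R / m.+1%:R < lam.
  rewrite ltr_pdivrMr // mulrC -ltr_pdivrMr //.
  have : N%:R / lam < m%:R by apply: archi_boundP; rewrite divr_ge0 // ltW.
  by move=> /lt_trans; apply; rewrite ltr_nat.
pose grid (u : 'I_N -> nat) := forall i, (u i <= m.+1)%N.
pose t (u : 'I_N -> nat) (i : 'I_N) : R := (u i)%:R / m.+1%:R.
have tI u : grid u -> forall i, 0 <= t u i <= 1.
  by move=> gu i; rewrite divr_ge0 //= ler_pdivrMr // mul1r ler_nat.
have color u : exists B, grid u -> V B /\ forall y, d (s (t u)) y < lam -> B y.
  have [gu|ngu] := pselect (grid u); last by exists setT.
  by have [B VB HB] := Hlam _ (sK _ (tI _ gu)); exists B.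
have [B HB] := choice color.
have noopp u w i : grid u -> grid w -> u i = 0%N -> w i = m.+1 -> B u <> B w.
  move=> gu gw ui wi e.
  have [VB Bu] := HB u gu; have [_ Bw] := HB w gw.
  have [_ [S _ <-] BS] := VU _ VB.
  have xu : US S (s (t u)) by apply/BS/Bu; rewrite mdistxx.
  have xw : US S (s (t w)) by apply/BS; rewrite e; apply: Bw; rewrite mdistxx.
  have := Hs (t u) i (tI u gu); have := Hs (t w) i (tI w gw).
  have -> : t u i = 0 by rewrite /t ui mul0r.
  have -> : t w i = 1 by rewrite /t wi divff.
  have := xu i; have := xw i; rewrite !ler_norml.
  case: ifP => _ h1 h2 /andP[h3 h4] /andP[h5 h6]; lra.
pose far (u : 'I_N -> nat) (i : 'I_N) : bool :=
  `[< exists w, [/\ grid w, w i = m.+1 & B w = B u] >].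
(* The label depends on the colour only; it is N if the colour touches no upper
   face. *)
pose L (u : 'I_N -> nat) := find (far u) (enum 'I_N).
have [u gu|v [p Lp]] := @kuhn_cubical_sperner N m L.
  split.
  - by rewrite (leq_trans (find_size _ _)) // size_enum_ord.
  - move=> i ui Lu.
    have : has (far u) (enum 'I_N) by rewrite has_find size_enum_ord -/(L u) Lu.
    move/(nth_find i); rewrite -/(L u) Lu nth_ord_enum => /asboolP [w [gw wi e]].
    exact: (noopp u w i).
  - move=> i ui; rewrite leqNgt; apply/negP => /(before_find i).
    by rewrite nth_ord_enum => /asboolPn; apply; exists u.
pose vtx := kuhn_vertex (fun i => v i) p.
have gv k : grid (vtx k).
  move=> i; rewrite /vtx /kuhn_vertex; have := ltn_ord (v i).
  by case: (ltnP (p i) k) => _ /=; lia.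
have vV k : V (B (vtx k)) by have [] := HB _ (gv k).
have v0 k : B (vtx k) (s (t (vtx 0%N))).
  have [_] := HB _ (gv k); apply.
  apply: (le_lt_trans (slip _ _ (tI _ (gv k)) (tI _ (gv 0%N)))).
  apply: le_lt_trans Nm.
  have -> : N%:R / m.+1%:R = \sum_(i < N) m.+1%:R^-1 :> R.
    by rewrite sumr_const card_ord mulr_natl.
  apply: ler_sum => i _; rewrite /t -mulrBl normrM [`|_^-1|]ger0_norm //.
  rewrite ler_piMl // /vtx /kuhn_vertex ltn0 addn0 natrD addrAC subrr add0r.
  by case: (_ < _)%N; rewrite /= ?normr1 ?normr0.
suff : (`I_N.+1 #<= `I_N)%card by rewrite card_le_II ltnn.
apply: card_le_trans (Vm (s (t (vtx 0%N)))).
have inj : {in `I_N.+1 &, injective (fun k => B (vtx k))}.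
  move=> j k; rewrite !inE /= => jN kN e.
  by apply: Lp => //; rewrite -/vtx /L /far e.
rewrite -(card_le_eql (inj_card_eq inj)); apply: subset_card_le.
by move=> _ [k _ <-].
Qed.

End Dimension.
(** * Functions that are almost coordinates *)

Section AlmostCoordinates.
Variables (R : realType) (X : metricType R) (n : nat) (del : R).
Local Notation d := (@mdist R X).

(** In the application f j and g j are the Busemann functions of xi_j and eta_j,
    and P j, Q j walk along the rays to xi_j and eta_j. *)
Variables (f g : 'I_n -> X -> R) (P Q : 'I_n -> X -> R -> X).
Hypothesis del0 : 0 < del.
Hypothesis P_dist : forall j q t, 0 <= t -> d q (P j q t) = t.
Hypothesis Q_dist : forall j q t, 0 <= t -> d q (Q j q t) = t.
Hypothesis P_f : forall j q t, 0 <= t -> f j (P j q t) = f j q - t.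
Hypothesis Q_g : forall j q t, 0 <= t -> g j (Q j q t) = g j q - t.
Hypothesis P_stewart : forall j y q t, 0 <= t ->
  d y (P j q t) ^+ 2 <= d y q ^+ 2 + 2 * t * (f j y - f j q) + t ^+ 2.
Hypothesis Q_stewart : forall j y q t, 0 <= t ->
  d y (Q j q t) ^+ 2 <= d y q ^+ 2 + 2 * t * (g j y - g j q) + t ^+ 2.
Hypothesis fg_lip : forall j x y, (f j y + g j y) - (f j x + g j x) <= del * d x y.
Hypothesis P_off : forall j k q t, j != k -> 0 <= t ->
  f k (P j q t) - f k q <= del * t /\ g k (P j q t) - g k q <= del * t.
Hypothesis Q_off : forall j k q t, j != k -> 0 <= t ->
  f k (Q j q t) - f k q <= del * t /\ g k (Q j q t) - g k q <= del * t.

Lemma P_off_abs j k q t : j != k -> 0 <= t ->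
  `|f k (P j q t) - f k q| <= 2 * del * t.
Proof.
move=> jk t0; have [h1 h2] := P_off q jk t0.
have := fg_lip k (P j q t) q; rewrite metric_sym P_dist //.
by have := mulr_ge0 (ltW del0) t0; rewrite ler_norml => *; apply/andP; split; lra.
Qed.

Lemma Q_off_abs j k q t : j != k -> 0 <= t ->
  `|f k (Q j q t) - f k q| <= 2 * del * t.
Proof.
move=> jk t0; have [h1 h2] := Q_off q jk t0.
have := fg_lip k (Q j q t) q; rewrite metric_sym Q_dist //.
by have := mulr_ge0 (ltW del0) t0; rewrite ler_norml => *; apply/andP; split; lra.
Qed.

(** A walk to xi_j lowers f j; to raise it one walks to eta_j, as g j is nearly
    - f j. *)
Definition move_coord j (tau : R) q := if tau <= 0 then P j q (- tau) else Q j q tau.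

Lemma move_dist j tau q : d q (move_coord j tau q) = `|tau|.
Proof.
rewrite /move_coord; case: (ltrgt0P tau) => t0.
- by rewrite Q_dist // ltW.
- by rewrite P_dist ?ltr0_norm // oppr_ge0 ltW.
- by rewrite t0 P_dist oppr0.
Qed.

Lemma move_self j tau q : `|f j (move_coord j tau q) - f j q - tau| <= del * `|tau|.
Proof.
rewrite /move_coord; case: (leP tau 0) => t0.
  rewrite P_f ?oppr_ge0 //.
  have -> : f j q - - tau - f j q - tau = 0 by ring.
  by rewrite normr0 mulr_ge0 // ltW.
have t0' := ltW t0.
have h1 := fg_lip j q (Q j q tau); have h2 := fg_lip j (Q j q tau) q.
rewrite (metric_sym (Q j q tau)) in h2.
rewrite !Q_dist // !Q_g // in h1 h2; rewrite [`|tau|]gtr0_norm // ler_norml.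
by apply/andP; split; lra.
Qed.

Lemma move_off j k tau q : j != k ->
  `|f k (move_coord j tau q) - f k q| <= 2 * del * `|tau|.
Proof.
move=> jk; rewrite /move_coord; case: (leP tau 0) => t0.
  by rewrite [`|tau|]ler0_norm //; apply: P_off_abs; rewrite ?oppr_ge0.
by rewrite [`|tau|]gtr0_norm //; apply: Q_off_abs => //; exact: ltW.
Qed.

Lemma move_stewart j y tau q :
  d y (move_coord j tau q) ^+ 2 <=
  d y q ^+ 2 - 2 * tau * (f j y - f j q) + tau ^+ 2 + 2 * del * `|tau| * d y q.
Proof.
have Dn := mdist_ge0 y q.
rewrite /move_coord; case: (leP tau 0) => t0.
  have t0' : 0 <= - tau by rewrite oppr_ge0.
  apply: (le_trans (P_stewart j y q t0')); rewrite sqrrN.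
  have := mulr_ge0 (mulr_ge0 (ltW del0) (normr_ge0 tau)) Dn; lra.
have t0' := ltW t0.
apply: (le_trans (Q_stewart j y q t0')); rewrite gtr0_norm //.
have := ler_wpM2l t0' (fg_lip j q y); rewrite (metric_sym q y); lra.
Qed.

Definition move_all (s : seq 'I_n) (tau : 'I_n -> R) (x : X) :=
  foldr (fun j q => move_coord j (tau j) q) x s.

Lemma move_all_dist s tau x : d x (move_all s tau x) <= \sum_(j <- s) `|tau j|.
Proof.
elim: s => [|j s IH] /=; first by rewrite mdistxx big_nil.
rewrite big_cons addrC; apply: (le_trans (metric_triangle _ _ _) (lerD IH _)).
by rewrite move_dist.
Qed.

Lemma move_all_coord s tau x k : uniq s ->
  `|f k (move_all s tau x) - f k x - (if k \in s then tau k else 0)| <=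
  2 * del * \sum_(j <- s) `|tau j|.
Proof.
elim: s => [|j s IH] /=; first by rewrite subrr subr0 normr0 big_nil mulr0.
move=> /andP[js /IH]; set q := move_all s tau x => h.
rewrite big_cons mulrDr in_cons; have [kj|kj] := eqVneq k j.
  rewrite kj (negbTE js) subr0 in h; rewrite kj /=.
  have -> : f j (move_coord j (tau j) q) - f j x - tau j =
    (f j (move_coord j (tau j) q) - f j q - tau j) + (f j q - f j x) by ring.
  apply: (le_trans (ler_normD _ _)); apply: lerD => //.
  apply: (le_trans (move_self _ _ _)); rewrite ler_wpM2r //; have := del0; lra.
rewrite /=; set e := (if _ then _ else _) in h *.
have -> : f k (move_coord j (tau j) q) - f k x - e =
    (f k (move_coord j (tau j) q) - f k q) + (f k q - f k x - e) by ring.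
apply: (le_trans (ler_normD _ _)); apply: lerD => //.
by apply: move_off; rewrite eq_sym.
Qed.

(** Here S is any bound for the length of the whole walk. It controls how far
    the walk has drifted when each of its steps is compared with the starting
    point x. *)
Lemma move_all_stewart s tau x y S : uniq s -> \sum_(j <- s) `|tau j| <= S ->
  d y (move_all s tau x) ^+ 2 <= d y x ^+ 2
    + \sum_(j <- s) (tau j ^+ 2 - 2 * tau j * (f j y - f j x))
    + 2 * del * (\sum_(j <- s) `|tau j|) * (3 * S + d y x).
Proof.
elim: s => [|j s IH] /=; first by rewrite !big_nil mulr0 mul0r !addr0.
move=> /andP[js us]; rewrite !big_cons; set Sg := \sum_(j <- s) `|tau j| => hS.
have t0 := normr_ge0 (tau j).
have Sg0 : 0 <= Sg by apply: sumr_ge0.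
have SS : Sg <= S by lra.
have := IH us SS; rewrite -/Sg; set q := move_all s tau x => h.
apply: (le_trans (move_stewart _ _ _ _)).
have hc := move_all_coord tau x j us; rewrite (negbTE js) subr0 -/q -/Sg in hc.
have hd := move_all_dist s tau x; rewrite -/q -/Sg in hd.
have k1 : `|tau j * (f j q - f j x)| <= `|tau j| * (2 * del * S).
  rewrite normrM ler_wpM2l //; apply: (le_trans hc).
  by rewrite ler_wpM2l // mulr_ge0 // ltW.
have k2 : d y q <= d y x + S.
  by apply: (le_trans (metric_triangle _ x _)); rewrite lerD2l; lra.
have k3 := ler_wpM2l (mulr_ge0 (ltW del0) t0) k2.
have := ler_norm (tau j * (f j q - f j x)).
lra.
Qed.

Lemma sum_abs_le (tau : 'I_n -> R) D : (forall j, `|tau j| <= D) ->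
  \sum_j `|tau j| <= n%:R * D.
Proof.
move=> H; apply: (@le_trans _ _ (\sum_(j < n) D)); first exact: ler_sum.
by rewrite sumr_const card_ord mulr_natl.
Qed.

Hypothesis f_lip : forall j x y, `|f j x - f j y| <= d x y.

(** The walk from x through the coordinate differences of y cannot bring the
    squared distance to y below 0. *)
Lemma coords_upper x y :
  \sum_j (f j x - f j y) ^+ 2 <= (1 + 2 * del * n%:R * (3 * n%:R + 1)) * d x y ^+ 2.
Proof.
pose tau j := f j y - f j x; set D := d x y.
have D0 : 0 <= D by apply: mdist_ge0.
have tD j : `|tau j| <= D by rewrite /tau distrC f_lip.
have hS := sum_abs_le tD; set S := \sum_j _ in hS.
have S0 : 0 <= S by apply: sumr_ge0.
have := @move_all_stewart (enum 'I_n) tau x y S (enum_uniq _).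
rewrite !big_enum /= -/S => /(_ (lexx _)) h.
have -> : \sum_j (f j x - f j y) ^+ 2 = \sum_j tau j ^+ 2.
  by apply: eq_bigr => j _; rewrite -opprB sqrrN.
have e1 : \sum_j (tau j ^+ 2 - 2 * tau j * (f j y - f j x)) = - \sum_j tau j ^+ 2.
  by rewrite -sumrN; apply: eq_bigr => j _; rewrite /tau; ring.
rewrite e1 (metric_sym y x) -/D in h.
have := le_trans (sqr_ge0 _) h.
have k1 : S * (3 * S + D) <= n%:R * D * (3 * (n%:R * D) + D).
  by apply: ler_pM => //; [rewrite addr_ge0 // mulr_ge0|rewrite lerD2r ler_pM2l].
have := ler_wpM2l (ltW del0) k1.
set Sq := \sum_j _ ; lra.
Qed.

Lemma coords_improve (z : 'I_n -> R) x : exists q,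
  \sum_j `|f j q - z j| <= 2 * del * n%:R * \sum_j `|f j x - z j|.
Proof.
pose tau j := z j - f j x; exists (move_all (enum 'I_n) tau x).
have -> : \sum_j `|f j x - z j| = \sum_j `|tau j|.
  by apply: eq_bigr => j _; rewrite distrC.
apply: (le_trans (sum_abs_le (D := 2 * del * \sum_j `|tau j|) _)).
  move=> k; have := @move_all_coord (enum 'I_n) tau x k (enum_uniq _).
  rewrite mem_enum /= big_enum /=.
  by have -> : forall a, a - f k x - tau k = a - z k by move=> a; rewrite /tau; ring.
by rewrite le_eqVlt; apply/orP; left; apply/eqP; ring.
Qed.

End AlmostCoordinates.
(** * Independent flows bound the dimension from below *)

Section FlowObstruction.
Variables (R : realType) (X : metricType R).
Local Notation d := (@mdist R X).

Hypothesis balls : forall (p : X) r, compact [set x | d p x <= r].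

Lemma lipschitz_continuous (h : X -> R) C :
  (forall x y, `|h x - h y| <= C * d x y) -> continuous h.
Proof.
move=> H x; apply/cvgrPdist_lt => e e0.
have C1 : 0 < `|C| + 1 by rewrite ltr_wpDl.
apply/nbhs_ballP; exists (e / (`|C| + 1)); first by rewrite /= divr_gt0.
move=> y; rewrite ballEmdist /= ltr_pdivlMr // => xy.
apply: (le_lt_trans (H x y)); apply: le_lt_trans xy; rewrite mulrC.
apply: ler_wpM2l; first exact: mdist_ge0.
by rewrite (le_trans (ler_norm _)) // lerDl.
Qed.

Section Chain.
Variables (N : nat) (phi : 'I_N -> X -> R -> X).
Hypothesis phi_dist : forall i q t, 0 <= t -> d q (phi i q t) = t.
Hypothesis phi_lip : forall i q q' t t', 0 <= t -> 0 <= t' ->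
  d (phi i q t) (phi i q' t') <= d q q' + `|t - t'|.

Definition chain (s : seq 'I_N) (t : 'I_N -> R) (x : X) :=
  foldr (fun i q => phi i q (t i)) x s.

Lemma chain_dist s t x : (forall i, 0 <= t i) -> d x (chain s t x) <= \sum_(i <- s) t i.
Proof.
move=> t0; elim: s => [|i s IH] /=; first by rewrite mdistxx big_nil.
rewrite big_cons addrC; apply: (le_trans (metric_triangle _ _ _) (lerD IH _)).
by rewrite phi_dist.
Qed.

Lemma chain_lip s t u x : (forall i, 0 <= t i) -> (forall i, 0 <= u i) ->
  d (chain s t x) (chain s u x) <= \sum_(i <- s) `|t i - u i|.
Proof.
move=> t0 u0; elim: s => [|i s IH] /=; first by rewrite mdistxx big_nil.
rewrite big_cons addrC; apply: (le_trans (phi_lip _ _ _ (t0 i) (u0 i))).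
by rewrite lerD2r.
Qed.

Lemma chain_change (b : X -> R) (c : 'I_N -> R) rho s t x :
  (forall i q t, 0 <= t -> `|b (phi i q t) - b q - c i * t| <= rho * t) ->
  (forall i, 0 <= t i) ->
  `|b (chain s t x) - b x - \sum_(i <- s) c i * t i| <= rho * \sum_(i <- s) t i.
Proof.
move=> H t0; elim: s => [|i s IH] /=; first by rewrite !big_nil mulr0 subrr subr0 normr0.
rewrite !big_cons mulrDr; set q := chain s t x in IH *.
have -> : b (phi i q (t i)) - b x - (c i * t i + \sum_(j <- s) c j * t j) =
  (b (phi i q (t i)) - b q - c i * t i) + (b q - b x - \sum_(j <- s) c j * t j) by ring.
by apply: (le_trans (ler_normD _ _)); apply: lerD => //; exact: H.
Qed.

(** Composing the flows gives a map from the cube to X for which the functions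
    H i are almost a left inverse. *)
Lemma flows_obstruction (x : X) (H : 'I_N -> X -> R) C rho :
  (forall i x y, `|H i x - H i y| <= C * d x y) -> 0 <= rho ->
  (forall i k q t, 0 <= t ->
     `|H i (phi k q t) - H i q - (i == k)%:R * t| <= rho * t) ->
  rho * N%:R <= 1 / 4 -> ~ has_refinements X N.
Proof.
move=> HC rho0 Hphi rhoN.
have sumN (t : 'I_N -> R) : (forall i, 0 <= t i <= 1) -> \sum_i t i <= N%:R.
  move=> t01; apply: (@le_trans _ _ (\sum_(i < N) 1)).
    by apply: ler_sum => i _; have /andP[] := t01 i.
  by rewrite sumr_const card_ord.
have pos (t : 'I_N -> R) : (forall i, 0 <= t i <= 1) -> forall i, 0 <= t i.
  by move=> t01 i; have /andP[] := t01 i.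
apply: (@cube_obstruction R X N [set q | d x q <= N%:R]
  (fun t => chain (enum 'I_N) t x) (fun i q => H i q - H i x)).
- exact: balls.
- move=> i; apply: (@lipschitz_continuous _ C) => y z.
  by have -> : H i y - H i x - (H i z - H i x) = H i y - H i z by ring.
- move=> t t01 /=; apply: (le_trans (chain_dist _ _ (pos _ t01))).
  by rewrite big_enum /= sumN.
- move=> t u t01 u01; apply: (le_trans (chain_lip _ _ (pos _ t01) (pos _ u01))).
  by rewrite big_enum.
- move=> t i t01.
  have := @chain_change (H i) (fun k => (i == k)%:R) rho (enum 'I_N) t x
    (Hphi i) (pos _ t01).
  rewrite !big_enum /= (bigD1 i) //= eqxx [true%:R * _]mul1r big1 ?addr0; last first.
    by move=> k ki; rewrite eq_sym (negbTE ki) mul0r.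
  move=> /le_trans; apply; apply: le_trans rhoN.
  by rewrite ler_wpM2l ?sumN.
Qed.

End Chain.

Lemma combo_bound n (al e : 'I_n -> R) e0 K s : 0 < K ->
  (forall j, `|al j| <= 1) -> `|e0| <= s -> (forall j, `|e j| <= s) ->
  `|(- e0 - \sum_j al j * e j) / K| <= n.+1%:R * s / K.
Proof.
have Kn (K1 : R) : 0 < K1 -> `|K1^-1| = K1^-1.
  by move=> K1p; rewrite ger0_norm // invr_ge0 ltW.
move=> K0 al1 e0s es; rewrite normrM Kn //.
apply: ler_wpM2r; first by rewrite invr_ge0 ltW.
apply: (le_trans (ler_normB _ _)); rewrite normrN.
rewrite mulrS mulrDl mul1r; apply: lerD => //.
apply: (le_trans (ler_norm_sum _ _ _)).
apply: (@le_trans _ _ (\sum_(j < n) s)); last by rewrite sumr_const card_ord mulr_natl.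
apply: ler_sum => j _; rewrite normrM -[s]mul1r; exact: ler_pM.
Qed.

(** The functions f j and h change under the n + 1 flows by the matrix with
    blocks - 1, al, al^T, - 1. The functions H below are obtained by inverting
    it: first [Hn], from the Schur complement K = 1 - |al|^2, and then the
    others by back substitution. *)
Lemma dimension_bound n (f : 'I_n -> X -> R) (h : X -> R)
    (P : 'I_n -> X -> R -> X) (Z : X -> R -> X) (al : 'I_n -> R) sg ka (x : X) :
  (forall j x y, `|f j x - f j y| <= d x y) -> (forall x y, `|h x - h y| <= d x y) ->
  (forall j q t, 0 <= t -> d q (P j q t) = t) -> (forall q t, 0 <= t -> d q (Z q t) = t) ->
  (forall j q q' t t', 0 <= t -> 0 <= t' -> d (P j q t) (P j q' t') <= d q q' + `|t - t'|) ->
  (forall q q' t t', 0 <= t -> 0 <= t' -> d (Z q t) (Z q' t') <= d q q' + `|t - t'|) ->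
  (forall j k q t, 0 <= t -> `|f k (P j q t) - f k q + (k == j)%:R * t| <= sg * t) ->
  (forall j q t, 0 <= t -> `|f j (Z q t) - f j q - al j * t| <= sg * t) ->
  (forall j q t, 0 <= t -> `|h (P j q t) - h q - al j * t| <= sg * t) ->
  (forall q t, 0 <= t -> h (Z q t) = h q - t) ->
  0 <= sg -> 0 < ka -> ka <= 1 - \sum_j al j ^+ 2 ->
  sg * n.+2%:R / ka * n.+1%:R <= 1 / 4 ->
  ~ has_refinements X n.+1.
Proof.
move=> f_lip h_lip Pd Zd Pl Zl Pf Zf Ph Zh sg0 ka0 kaK small.
set K := 1 - _ in kaK; have K0 : 0 < K by exact: lt_le_trans kaK.
have al2 : 0 <= \sum_j al j ^+ 2 by apply: sumr_ge0 => j _; exact: sqr_ge0.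
have K1 : K <= 1 by rewrite /K; lra.
have al1 j : `|al j| <= 1.
  rewrite -ler_sqr ?nnegrE // expr1n real_normK ?num_real //.
  have : al j ^+ 2 <= \sum_j al j ^+ 2.
    by rewrite (bigD1 j) //= lerDl; apply: sumr_ge0 => k _; exact: sqr_ge0.
  by move: K0; rewrite /K; lra.
pose Hn q := (- h q - \sum_j al j * f j q) / K.
pose H (i : 'I_n.+1) q :=
  if unlift ord_max i is Some j then - f j q + al j * Hn q else Hn q.
pose phi (i : 'I_n.+1) q t := if unlift ord_max i is Some j then P j q t else Z q t.
have HnE q q' (a0 : R) (a : 'I_n -> R) :
    Hn q' - Hn q - (- a0 - \sum_j al j * a j) / K =
    (- (h q' - h q - a0) - \sum_j al j * (f j q' - f j q - a j)) / K.
  rewrite /Hn -!mulrBl; congr (_ / _).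
  have -> : \sum_j al j * (f j q' - f j q - a j) =
    \sum_j al j * f j q' - \sum_j al j * f j q - \sum_j al j * a j.
    by rewrite -!sumrB; apply: eq_bigr => j _; ring.
  by ring.
have step q q' (a0 : R) (a : 'I_n -> R) s :
    `|h q' - h q - a0| <= s -> (forall j, `|f j q' - f j q - a j| <= s) ->
    `|Hn q' - Hn q - (- a0 - \sum_j al j * a j) / K| <= n.+1%:R * s / K /\
    forall j, `|(- f j q' + al j * Hn q') - (- f j q + al j * Hn q) -
       (- a j + al j * ((- a0 - \sum_j al j * a j) / K))| <= s + n.+1%:R * s / K.
  move=> hs fs; have h1 : `|Hn q' - Hn q - (- a0 - \sum_j al j * a j) / K|
      <= n.+1%:R * s / K by rewrite HnE; exact: combo_bound.
  split => // j; set c := (_ / K) in h1 *.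
  have -> : (- f j q' + al j * Hn q') - (- f j q + al j * Hn q) - (- a j + al j * c) =
     - (f j q' - f j q - a j) + al j * (Hn q' - Hn q - c) by ring.
  apply: (le_trans (ler_normD _ _)); rewrite normrN; apply: lerD => //.
  by rewrite normrM -[leRHS]mul1r; apply: ler_pM.
have rhoE : n.+2%:R * sg / K <= sg * n.+2%:R / ka.
  rewrite mulrC (mulrC sg) [leLHS]mulrC; apply: ler_wpM2l; first by rewrite mulr_ge0.
  by rewrite lef_pV2.
have le1 s : 0 <= s -> s + n.+1%:R * s / K <= n.+2%:R * s / K.
  move=> s0; rewrite [n.+2%:R]mulrS mulrDl mul1r mulrDl lerD2r.
  by rewrite ler_pdivlMr // ler_piMr.
have le2 s : 0 <= s -> n.+1%:R * s / K <= n.+2%:R * s / K.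
  by move=> s0; apply: le_trans (le1 s s0); rewrite lerDr.
apply: (@flows_obstruction n.+1 phi _ _ x H (n.+2%:R / K) (sg * n.+2%:R / ka)).
- by move=> i q t t0; rewrite /phi; case: unlift => [j|]; [exact: Pd|exact: Zd].
- by move=> i q q' t t' t0 t0'; rewrite /phi; case: unlift => [j|]; [exact: Pl|exact: Zl].
- move=> i y z; have [||h1 h2] := @step z y 0 (fun=> 0) (d y z).
  + by rewrite subr0; exact: h_lip.
  + by move=> j; rewrite subr0; exact: f_lip.
  rewrite mulrAC; move: h1 h2; have -> : - 0 - \sum_(j < n) al j * 0 = 0 :> R.
    by rewrite big1 ?subr0 ?oppr0 // => j _; rewrite mulr0.
  rewrite mul0r subr0 => h1 h2; rewrite /H; case: unlift => [j|].
    have := h2 j; rewrite mulr0 oppr0 addr0 subr0 => /le_trans; apply.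
    exact/le1/mdist_ge0.
  by apply: (le_trans h1); exact/le2/mdist_ge0.
- by rewrite divr_ge0 ?mulr_ge0 // ltW.
- move=> i k q t t0; apply: (@le_trans _ _ (n.+2%:R * sg / K * t)); last first.
    exact: ler_wpM2r.
  have -> : n.+2%:R * sg / K * t = n.+2%:R * (sg * t) / K by ring.
  have st0 : 0 <= sg * t by rewrite mulr_ge0.
  case: (unliftP ord_max k) => [k'|] ->.
  + rewrite /phi liftK.
    have fs j : `|f j (P k' q t) - f j q - (- (j == k')%:R * t)| <= sg * t.
      by rewrite mulNr opprK; exact: Pf.
    have [h1 h2] := step _ _ _ _ _ (Ph k' q t t0) fs.
    have c0 : - (al k' * t) - \sum_j al j * (- (j == k')%:R * t) = 0.
      rewrite (bigD1 k') //= eqxx /= big1 ?addr0; first by ring.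
      by move=> j /negbTE ->; rewrite oppr0 mul0r mulr0.
    rewrite c0 mul0r subr0 in h1.
    rewrite /H; case: (unliftP ord_max i) => [j|] ->.
      have := h2 j; rewrite c0 mul0r mulr0 addr0 mulNr opprK.
      by rewrite (inj_eq lift_inj) => /le_trans; apply; exact: le1.
    rewrite (negbTE (neq_lift _ _)) mul0r subr0.
    by apply: (le_trans h1); exact: le2.
  + rewrite /phi unlift_none.
    have hs : `|h (Z q t) - h q - (- t)| <= sg * t.
      by rewrite Zh // opprK addrAC subrK subrr normr0.
    have [h1 h2] := step _ _ _ _ _ hs (fun j => Zf j q t t0).
    have c0 : (- (- t) - \sum_j al j * (al j * t)) / K = t.
      have -> : \sum_j al j * (al j * t) = (\sum_j al j ^+ 2) * t.
        by rewrite mulr_suml; apply: eq_bigr => j _; ring.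
      rewrite opprK -{1}[t]mul1r -mulrBl -/K mulrAC divff ?mul1r //.
      by rewrite gt_eqF.
    rewrite c0 in h1.
    rewrite /H; case: (unliftP ord_max i) => [j|] ->.
      have := h2 j; rewrite c0 addNr subr0 eq_sym (negbTE (neq_lift _ _)) mul0r subr0.
      by move=> /le_trans; apply; exact: le1.
    by rewrite eqxx mul1r; apply: (le_trans h1); exact: le2.
- exact: small.
Qed.

End FlowObstruction.
(** * Comparison geometry *)

Section Cat0.
Variables (R : realType) (X : metricType R).
Local Notation d := (@mdist R X).

Definition row2 (a b : R) : 'rV[R]_2 := \row_(j < 2) (if j == ord0 then a else b).

Lemma eucl_dist_row2 a b a' b' :
  eucl_dist (row2 a b) (row2 a' b') = Num.sqrt ((a - a') ^+ 2 + (b - b') ^+ 2).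
Proof. by rewrite /eucl_dist !big_ord_recl big_ord0 !mxE /= addr0. Qed.

Lemma eucl_dist_sym n (u v : 'rV[R]_n) : eucl_dist u v = eucl_dist v u.
Proof. by congr Num.sqrt; apply: eq_bigr => i _; rewrite -opprB sqrrN. Qed.

Lemma eucl_distxx n (u : 'rV[R]_n) : eucl_dist u u = 0.
Proof. by rewrite /eucl_dist big1 ?sqrtr0 // => i _; rewrite subrr expr0n. Qed.

Lemma Z3_cases (i : 'Z_3) : [\/ i = 0, i = 1 | i = 2].
Proof.
by case: i => [[|[|[|//]]] h];
  [constructor 1|constructor 2|constructor 3]; apply: val_inj.
Qed.

Lemma dist_abs (x y z : X) : `|d x y - d x z| <= d y z.
Proof.
have := metric_triangle x y z; have := metric_triangle x z y.
rewrite (metric_sym z y) => h1 h2; rewrite ler_norml; apply/andP; split; lra.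
Qed.

Lemma geodesic_dist c l s t : geodesic_on `[0, l] c ->
  0 <= s -> s <= t -> t <= l -> d (c s) (c t) = t - s.
Proof.
move=> gc s0 st tl; rewrite gc /= ?in_itv /= ?s0 ?tl ?andbT ?(le_trans st) //.
- by rewrite distrC ger0_norm // subr_ge0.
- exact: le_trans st.
Qed.

Lemma comparison_triangle (a b e : R) : 0 < a -> 0 <= b -> `|b - e| <= a -> a <= b + e ->
  exists p q : R, p ^+ 2 + q ^+ 2 = b ^+ 2 /\ (p - a) ^+ 2 + q ^+ 2 = e ^+ 2.
Proof.
move=> a0 b0; rewrite ler_norml => /andP[h1 h2] h3.
pose p := (b ^+ 2 + a ^+ 2 - e ^+ 2) / (2 * a).
have pa : p * (2 * a) = b ^+ 2 + a ^+ 2 - e ^+ 2 by rewrite /p; field; lra.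
have pb : p ^+ 2 <= b ^+ 2.
  rewrite -ler_sqrt ?sqr_ge0 // !sqrtr_sqr (ger0_norm b0) ler_norml.
  have a20 : 0 < 2 * a by lra.
  rewrite -(ler_pM2r a20) -[p <= _](ler_pM2r a20) pa.
  have k1 : 0 <= (e - (b - a)) * (e + (b - a)) by apply: mulr_ge0; lra.
  have k2 : 0 <= (a + b - e) * (a + b + e) by apply: mulr_ge0; lra.
  apply/andP; split; lra.
exists p, (Num.sqrt (b ^+ 2 - p ^+ 2)); rewrite sqr_sqrtr ?subr_ge0 //; split; first lra.
have -> : (p - a) ^+ 2 = p ^+ 2 - p * (2 * a) + a ^+ 2 by ring.
rewrite pa; lra.
Qed.

(** Stewart's identity in the comparison triangle. This inequality between a
    vertex and the opposite side carries all the curvature information needed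
    here; the factor l avoids a division. *)
Lemma cat0_stewart (y : X) c l t : cat0 X -> geodesic_on `[0, l] c -> 0 <= t <= l ->
  l * d y (c t) ^+ 2 <=
  (l - t) * d y (c 0) ^+ 2 + t * d y (c l) ^+ 2 - t * (l - t) * l.
Proof.
move=> [geo cat] gc /andP[t0 tl].
have [l0|lneq] := eqVneq l 0.
  have -> : t = 0 by lra.
  rewrite l0; lra.
have lpos : 0 < l by lra.
have dl : d (c 0) (c l) = l by rewrite (geodesic_dist gc) // ?subr0 //; lra.
have dt : d (c 0) (c t) = t by rewrite (geodesic_dist gc) // ?subr0.
have [||p [q [pq1 pq2]]] :=
  @comparison_triangle l (d (c 0) y) (d (c l) y) lpos (mdist_ge0 _ _).
- by rewrite -[X in _ <= X]dl -!(metric_sym y) dist_abs.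
- by rewrite -[X in X <= _]dl (metric_sym (c l)) metric_triangle.
pose v (i : 'Z_3) := if i == 0 then c 0 else if i == 1 then c l else y.
pose w (i : 'Z_3) := if i == 0 then row2 0 0 else if i == 1 then row2 l 0 else row2 p q.
have [S HS] : exists S : 'Z_3 -> set X, (forall i, is_segment (v i) (v (i + 1)) (S i)) /\
    S 0 = c @` `[0, l].
  have [S HS] := choice (fun i => geo (v i) (v (i + 1))).
  exists (fun i => if i == 0 then c @` `[0, l] else S i); split => // i.
  by case: ifP => [/eqP ->|_ //]; exists c; rewrite /v /= dl; split.
have sq a : 0 <= a -> Num.sqrt (a ^+ 2) = a :> R.
  by move=> a0; rewrite sqrtr_sqr ger0_norm.
have E01 : eucl_dist (row2 0 0) (row2 l 0) = d (c 0) (c l).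
  by rewrite eucl_dist_row2 subrr expr0n addr0 sub0r sqrrN dl sq // ltW.
have E02 : eucl_dist (row2 0 0) (row2 p q) = d (c 0) y.
  by rewrite eucl_dist_row2 !sub0r !sqrrN pq1 sq ?mdist_ge0.
have E12 : eucl_dist (row2 l 0) (row2 p q) = d (c l) y.
  rewrite eucl_dist_row2 sub0r sqrrN -[RHS]sq ?mdist_ge0 // -pq2.
  by rewrite -[in LHS]opprB sqrrN.
have wdist i j : eucl_dist (w i) (w j) = d (v i) (v j).
  have w0 : w 0 = row2 0 0 by []. have w1 : w 1 = row2 l 0 by [].
  have w2 : w 2 = row2 p q by []. have v0 : v 0 = c 0 by [].
  have v1 : v 1 = c l by []. have v2 : v 2 = y by [].
  case: (Z3_cases i) => ->; case: (Z3_cases j) => ->;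
    rewrite ?w0 ?w1 ?w2 ?v0 ?v1 ?v2 ?eucl_distxx ?mdistxx //;
    by rewrite eucl_dist_sym metric_sym.
have e01 : 0 + 1 = 1 :> 'Z_3 by apply: val_inj.
have xbE : row2 t 0 = (1 - t / l) *: w 0 + (t / l) *: w (0 + 1).
  rewrite e01 /w /=; apply/rowP => j; rewrite !mxE.
  by case: (j == ord0); field.
have cx : comparison_point v w 0 (c t) (row2 t 0).
  split; first by exists (t / l); rewrite // divr_ge0 //= ?ler_pdivrMr ?mul1r // ltW.
  by rewrite /w /v /= dt eucl_dist_row2 subrr expr0n addr0 sub0r sqrrN sqrtr_sqr ger0_norm.
have cy : comparison_point v w 2 y (w 2).
  split; last by rewrite wdist.
  by exists 0; rewrite ?lexx ?ler01 // subr0 scale1r scale0r addr0.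
have Sx : S 0 (c t) by rewrite HS.2; exists t => //=; rewrite in_itv /= t0.
have Sy : S 2 y.
  have [g [_ g0 _ ->]] := HS.1 2.
  by exists 0 => //=; rewrite in_itv /= lexx mdist_ge0.
have := cat v S w HS.1 wdist 0 2 (c t) y _ _ Sx Sy cx cy.
rewrite (_ : w 2 = row2 p q) // eucl_dist_row2 => le1.
have le2 : d y (c t) ^+ 2 <= (t - p) ^+ 2 + (0 - q) ^+ 2.
  rewrite -[leRHS]sqr_sqrtr ?addr_ge0 ?sqr_ge0 //.
  by rewrite ler_sqr ?nnegrE ?sqrtr_ge0 ?mdist_ge0 // metric_sym.
rewrite (metric_sym y (c 0)) (metric_sym y (c l)) -pq1 -pq2.
apply: le_trans (_ : l * ((t - p) ^+ 2 + (0 - q) ^+ 2) <= _); first by rewrite ler_pM2l.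
by rewrite le_eqVlt; apply/orP; left; apply/eqP; ring.
Qed.
Lemma geodesic_sub (I J : set R) c : J `<=` I -> geodesic_on (X := X) I c -> geodesic_on J c.
Proof. by move=> JI g s t /JI Is /JI It; exact: g. Qed.

Lemma geodesic_shift (I : set R) a l c : (forall t, 0 <= t <= l -> I (a + t)) ->
  geodesic_on (X := X) I c -> geodesic_on `[0, l] (fun t => c (a + t)).
Proof.
move=> HI g s t; rewrite /= !in_itv /= => s0 t0.
by rewrite g; [congr (`|_|); ring|exact: HI|exact: HI].
Qed.

Lemma geodesic_rev l c :
  geodesic_on (X := X) `[0, l] c -> geodesic_on `[0, l] (fun t => c (l - t)).
Proof.
move=> g s t; rewrite /= !in_itv /= => /andP[s0 sl] /andP[t0 tl].
by rewrite g /= ?in_itv /=; [rewrite distrC; congr (`|_|); ring|lra|lra].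
Qed.

Lemma ray_geodesic l c : is_ray (X := X) c -> geodesic_on `[0, l] c.
Proof. by apply: geodesic_sub => t; rewrite /= !in_itv /= => /andP[->]. Qed.

Lemma ray_dist c s t : is_ray (X := X) c -> 0 <= s -> s <= t -> d (c s) (c t) = t - s.
Proof. by move=> /(@ray_geodesic t) g s0 st; apply: (geodesic_dist g). Qed.

Hypothesis cat : cat0 X.

Definition seg (p q : X) (g : R -> X) :=
  [/\ geodesic_on `[0, d p q] g, g 0 = p & g (d p q) = q].

Lemma seg_exists p q : exists g, seg p q g.
Proof. by have [S [g [gg g0 g1 _]]] := (proj1 cat) p q; exists g. Qed.

Lemma dist_convex (y : X) c l t : geodesic_on `[0, l] c -> 0 <= t <= l ->
  l * d y (c t) <= (l - t) * d y (c 0) + t * d y (c l).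
Proof.
move=> g /andP[t0 tl]; have t0l : 0 <= t <= l by rewrite t0.
have := cat0_stewart y cat g t0l.
have gl : d (c 0) (c l) = l by rewrite (geodesic_dist g) ?subr0 //; lra.
have := dist_abs y (c 0) (c l); rewrite gl.
move: (mdist_ge0 y (c 0)) (mdist_ge0 y (c l)) (mdist_ge0 y (c t)).
set A := d y (c 0); set B := d y (c l); set D := d y (c t) => A0 B0 D0 AB st.
have l0 : 0 <= l by lra.
have AB2 : (A - B) ^+ 2 <= l ^+ 2 by rewrite -[leLHS]real_normK ?num_real // ler_sqr ?nnegrE.
rewrite -ler_sqr ?nnegrE; [|by apply: mulr_ge0|by apply: addr_ge0; apply: mulr_ge0 => //; lra].
have h1 : 0 <= t * (l - t) * (l ^+ 2 - (A - B) ^+ 2) by rewrite !mulr_ge0 //; lra.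
have h2 := ler_wpM2l l0 st.
have -> : (l * D) ^+ 2 = l * (l * D ^+ 2) by ring.
apply: (le_trans h2); rewrite -subr_ge0; apply: le_trans h1 _.
by rewrite le_eqVlt; apply/orP; left; apply/eqP; ring.
Qed.

(** The comparison of points on two sides of a triangle follows from two uses
    of the comparison between a vertex and a side, because both are equalities
    in the Euclidean plane. *)
Lemma two_geodesics c c' l l' t t' :
  geodesic_on (X := X) `[0, l] c -> geodesic_on (X := X) `[0, l'] c' -> c 0 = c' 0 ->
  0 <= t <= l -> 0 <= t' <= l' ->
  l * l' * d (c t) (c' t') ^+ 2 <=
  l * l' * (t ^+ 2 + t' ^+ 2) - t * t' * (l ^+ 2 + l' ^+ 2 - d (c l) (c' l') ^+ 2).
Proof.
move=> g g' c0 tI tI'; have /andP[t0 tl] := tI; have /andP[t0' tl'] := tI'.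
have := cat0_stewart (c t) cat g' tI'; have := cat0_stewart (c' l') cat g tI.
rewrite (metric_sym (c' l') (c t)) (metric_sym (c' l') (c l)) c0.
rewrite (metric_sym (c' l')) (metric_sym (c t) (c' 0)) -{2}c0.
rewrite (geodesic_dist g (lexx 0)) ?subr0 // (geodesic_dist g' (lexx 0)) ?subr0 //; last lra.
set e := d (c l) (c' l'); set f := d (c t) (c' l'); set D := d (c t) (c' t').
move=> h1 h2.
have l0 : 0 <= l by lra.
have := ler_wpM2l l0 h2; have := ler_wpM2l t0' h1 => k1 k2.
have -> : l * l' * D ^+ 2 = l * (l' * D ^+ 2) by ring.
apply: (le_trans k2); rewrite -subr_ge0; rewrite -subr_ge0 in k1.
apply: (le_trans k1); rewrite le_eqVlt; apply/orP; left; apply/eqP; ring.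
Qed.

Lemma same_time c c' l l' t :
  geodesic_on (X := X) `[0, l] c -> geodesic_on (X := X) `[0, l'] c' -> c 0 = c' 0 ->
  0 <= t <= l -> t <= l' ->
  l * l' * d (c t) (c' t) ^+ 2 <= t ^+ 2 * (d (c l) (c' l') ^+ 2 - (l - l') ^+ 2).
Proof.
move=> g g' c0 /andP[t0 tl] tl'.
have := two_geodesics g g' c0 (t := t) (t' := t); rewrite t0 tl tl' => /(_ isT isT).
move=> /le_trans; apply; rewrite le_eqVlt; apply/orP; left; apply/eqP; ring.
Qed.

Lemma scaled_geodesics c c' l l' lam : 0 <= l -> 0 <= l' ->
  geodesic_on (X := X) `[0, l] c -> geodesic_on (X := X) `[0, l'] c' -> c 0 = c' 0 ->
  0 <= lam <= 1 ->
  d (c (lam * l)) (c' (lam * l')) <= lam * d (c l) (c' l').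
Proof.
move=> l0 l0' g g' c0 /andP[a0 a1].
have sub m : 0 <= m -> 0 <= lam * m <= m by move=> m0; rewrite mulr_ge0 //= ler_piMl.
have [lz|ln] := eqVneq l 0.
  rewrite lz mulr0 c0 (geodesic_dist g' (lexx 0)) ?(geodesic_dist g' (lexx 0)) ?subr0 //.
    by have /andP[] := sub _ l0'.
  by have /andP[] := sub _ l0'.
have [lz|ln'] := eqVneq l' 0.
  rewrite lz mulr0 -c0 -!(metric_sym (c 0)).
  rewrite (geodesic_dist g (lexx 0)) ?(geodesic_dist g (lexx 0)) ?subr0 //.
    by have /andP[] := sub _ l0.
  by have /andP[] := sub _ l0.
have lp : 0 < l * l' by rewrite mulr_gt0 //; lra.
have := two_geodesics g g' c0 (sub _ l0) (sub _ l0').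
set D := d _ _; set e := d _ _ => h.
rewrite -ler_sqr ?nnegrE ?mulr_ge0 ?mdist_ge0 // -(ler_pM2l lp).
apply: (le_trans h); rewrite le_eqVlt; apply/orP; left; apply/eqP; ring.
Qed.

(** A diagonal of the quadrilateral splits it into two triangles, to each of
    which [scaled_geodesics] applies. *)
Lemma convex_pair c c' l l' lam : 0 <= l -> 0 <= l' ->
  geodesic_on (X := X) `[0, l] c -> geodesic_on (X := X) `[0, l'] c' ->
  0 <= lam <= 1 ->
  d (c (lam * l)) (c' (lam * l')) <=
  (1 - lam) * d (c 0) (c' 0) + lam * d (c l) (c' l').
Proof.
move=> l0 l0' g g' /andP[a0 a1].
have [h [gh h0 h1]] := seg_exists (c 0) (c' l').
set m := d (c 0) (c' l') in gh h1; have m0 : 0 <= m by apply: mdist_ge0.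
apply: (le_trans (metric_triangle _ (h (lam * m)) _)); rewrite addrC; apply: lerD.
  have := scaled_geodesics m0 l0' (geodesic_rev gh) (geodesic_rev g') (lam := 1 - lam).
  rewrite !subr0 h1 !subrr h0 => /(_ erefl).
  have -> : m - (1 - lam) * m = lam * m by ring.
  have -> : l' - (1 - lam) * l' = lam * l' by ring.
  by apply; lra.
by have := scaled_geodesics l0 m0 g gh (esym h0) (lam := lam); rewrite h1; apply; rewrite a0.
Qed.

(** If c is a geodesic from a to T, the inequality at the midpoint T of a short
    subsegment forces the distance from c a to grow at unit speed beyond T as
    well. *)
Lemma local_geodesicE c : local_geodesic (X := X) c -> geodesic_on setT c.
Proof.
move=> loc.
suff H a t : a <= t -> d (c a) (c t) = t - a.
  move=> s t _ _; have [st|ts] := leP s t.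
    by rewrite H // distrC ger0_norm ?subr_ge0.
  by rewrite metric_sym H ?(ltW ts) // ger0_norm // subr_ge0 ltW.
move=> at_; apply: contrapT => bad.
(* T is the first time at which c fails to be a geodesic from a. *)
pose B := [set u | a <= u /\ d (c a) (c u) <> u - a].
have Bi : has_inf B by split; [exists t|exists a => u []].
set T := inf B.
have aT : a <= T by apply: lb_le_inf; [exists t|move=> u []].
have good u : a <= u -> u < T -> d (c a) (c u) = u - a.
  move=> au uT; apply: contrapT => ng.
  by have := ge_inf (proj2 Bi) (conj au ng : B u); rewrite -/T leNgt uT.
have [e e0 ge] := loc T.
have geod u v : `|u - T| < e -> `|v - T| < e -> d (c u) (c v) = `|u - v|.
  by move=> hu hv; apply: ge; rewrite -ball_normE /= distrC.
have goodT : d (c a) (c T) = T - a.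
  have [->|nT] := eqVneq a T; first by rewrite mdistxx subrr.
  have aT' : a < T by lra.
  apply/eqP; rewrite -subr_eq0 -normr_le0; apply/ler_addgt0Pr => r r0; rewrite add0r.
  pose u := Num.min (Num.min (e / 2) (T - a)) (r / 2).
  have u0 : 0 < u by rewrite /u !lt_min; apply/andP; split; [apply/andP; split|]; lra.
  have ur : u <= r / 2 by rewrite /u ge_min lexx orbT.
  have : u <= Num.min (e / 2) (T - a) by rewrite /u ge_min lexx.
  rewrite le_min => /andP[ue uT].
  have := dist_abs (c a) (c T) (c (T - u)).
  have dTu : d (c T) (c (T - u)) = u.
    rewrite geod ?subrr ?normr0 //.
      by rewrite (_ : T - (T - u) = u) ?gtr0_norm //; ring.
    by rewrite (_ : T - u - T = - u) ?normrN ?gtr0_norm //; [lra|ring].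
  rewrite dTu => h1.
  have h2 : d (c a) (c (T - u)) = T - u - a by apply: good; lra.
  move: h1; rewrite h2 !ler_norml => /andP[h3 h4]; apply/andP; split; lra.
have [r r0 next] : exists2 r, 0 < r &
    forall v, 0 <= v < r -> d (c a) (c (T + v)) = T + v - a.
  have [->|nT] := eqVneq a T.
    exists e => // v /andP[v0 ve]; rewrite geod ?subrr ?normr0 //; last first.
      by rewrite addrC addKr ger0_norm.
    by rewrite distrC ger0_norm; lra.
  have aT' : a < T by lra.
  exists (Num.min e (T - a)); first by rewrite lt_min e0 subr_gt0.
  move=> v /andP[]; rewrite le_eqVlt => /orP[/eqP <- _|v0]; first by rewrite addr0.
  rewrite lt_min => /andP[ve vT].
  have dTv : d (c T) (c (T + v)) = v.
    rewrite geod ?subrr ?normr0 //; last by rewrite addrC addKr gtr0_norm.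
    by rewrite distrC addrC addKr gtr0_norm.
  have gs : geodesic_on `[0, v + v] (fun s => c (T - v + s)).
    apply: (@geodesic_shift (ball T e)) => // s sI; rewrite -ball_normE /=.
    by rewrite ltr_norml; apply/andP; split; lra.
  have vI : 0 <= v <= v + v by lra.
  have := cat0_stewart (c a) cat gs vI.
  rewrite addr0 subrK goodT good; [|lra|lra].
  have -> : T - v + (v + v) = T + v by ring.
  have -> : v + v - v = v by ring.
  set D := d _ _ => h.
  have hD : (T + v - a) ^+ 2 <= D ^+ 2.
    rewrite -(ler_pM2l v0); rewrite -subr_ge0 in h; rewrite -subr_ge0.
    by apply: (le_trans h); rewrite le_eqVlt; apply/orP; left; apply/eqP; ring.
  rewrite ler_sqr ?nnegrE ?mdist_ge0 // in hD; last lra.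
  apply: le_anti; rewrite hD andbT.
  by have := metric_triangle (c a) (c T) (c (T + v)); rewrite goodT dTv -/D; lra.
have [u [au ub] uT] := inf_adherent r0 Bi; rewrite -/T in uT.
have Tu : T <= u by apply: (ge_inf (proj2 Bi)).
apply: ub; have := next (u - T).
have -> : T + (u - T) = u by ring.
by apply; lra.
Qed.

(** * Rays with a prescribed end *)

Hypothesis prop : proper_space X.

Lemma dist_abs4 (a b a' b' : X) : `|d a b - d a' b'| <= d a a' + d b b'.
Proof.
have -> : d a b - d a' b' = (d a b - d a b') + (d a b' - d a' b') by ring.
apply: (le_trans (ler_normD _ _)); rewrite addrC; apply: lerD; last exact: dist_abs.
by rewrite !(metric_sym _ b') dist_abs.
Qed.

Lemma le_eps (x y : R) : (forall e, 0 < e -> x <= y + e) -> x <= y.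
Proof. by move=> H; apply/ler_addgt0Pr. Qed.

(** The distance between two rays is convex and bounded, hence nonincreasing. *)
Lemma asymptotic_contract c c' K : is_ray (X := X) c -> is_ray (X := X) c' ->
  (forall t, 0 <= t -> d (c t) (c' t) <= K) ->
  forall t, 0 <= t -> d (c t) (c' t) <= d (c 0) (c' 0).
Proof.
move=> rc rc' HK t t0; apply: le_eps => e e0.
have K0 : 0 <= K by apply: le_trans (HK 0 (lexx 0)); exact: mdist_ge0.
pose T := t + 1 + t * K / e.
have tK : 0 <= t * K / e by rewrite divr_ge0 ?mulr_ge0 // ltW.
have T0 : 0 < T by rewrite /T; lra.
have tT : 0 <= t / T <= 1.
  by rewrite divr_ge0 //= ?ler_pdivrMr ?mul1r /T ?(ltW T0) //; lra.
have := convex_pair (ltW T0) (ltW T0) (ray_geodesic rc) (ray_geodesic rc') tT.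
have -> : t / T * T = t by field; rewrite gt_eqF.
move=> /le_trans; apply; apply: lerD.
  by rewrite ler_piMl ?mdist_ge0 //; lra.
apply: (le_trans (y := t / T * K)); first by apply: ler_wpM2l; [lra|exact/HK/ltW].
rewrite mulrAC ler_pdivrMr // /T !mulrDr mulr1 (mulrC e (_ / e)) divfK ?gt_eqF //.
have := mulr_ge0 (ltW e0) t0; lra.
Qed.

(** The segments from p to far points of a ray form a Cauchy family: the
    comparison angle at p of the triangle with vertices p, gam T, gam T' is of
    order (D / T)^(1/2), where T <= T' and D is the distance from p to the
    origin of the ray. *)
Lemma seg_cauchy gam p t e : is_ray (X := X) gam -> 0 <= t -> 0 < e ->
  exists2 T0, t + d p (gam 0) <= T0 & forall T T' g g', T0 <= T -> T0 <= T' ->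
    seg p (gam T) g -> seg p (gam T') g' -> d (g t) (g' t) <= e.
Proof.
move=> rg t0 e0; set D := d p (gam 0).
have D0 : 0 <= D by apply: mdist_ge0.
have ge0 : 0 <= 4 * D * t ^+ 2 / e ^+ 2 by apply: divr_ge0; [apply: mulr_ge0; [lra|]|]; exact: sqr_ge0.
pose T0 := t + D + 1 + 4 * D * t ^+ 2 / e ^+ 2.
exists T0; first by rewrite /T0; lra.
move=> T T'; wlog TT : T T' / T <= T'.
  move=> H g g' hT hT' sg sg'; have [TT|TT] := leP T T'; first exact: (H T T').
  by rewrite metric_sym; apply: (H T' T) => //; exact: ltW.
move=> g g' hT hT' [gg g0 g1] [gg' g0' g1'].
have T_0 : 0 <= T by move: hT; rewrite /T0; lra.
have := dist_abs4 p (gam T) (gam 0) (gam T); rewrite mdistxx addr0 -/D.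
have := dist_abs4 p (gam T') (gam 0) (gam T'); rewrite mdistxx addr0 -/D.
have := dist_abs p (gam T) (gam T').
rewrite !(ray_dist rg) // ?(le_trans T_0 TT) // !subr0 !ler_norml.
have := same_time gg gg' (etrans g0 (esym g0')) (t := t).
rewrite g1 g1' (ray_dist rg) //.
set l := d p (gam T); set l' := d p (gam T') => st /andP[a1 a2] /andP[b1 b2] /andP[c1 c2].
have hT2 : T0 <= T by []. rewrite /T0 in hT2.
have tl : 0 <= t <= l by lra.
have tl' : t <= l' by lra.
have {}st := st tl tl'.
have l0 : 0 < l by lra. have l0' : 0 < l' by lra.
have k1 : (T' - T) ^+ 2 - (l - l') ^+ 2 <= 4 * D * l'.
  have -> : (T' - T) ^+ 2 - (l - l') ^+ 2 =
    (T' - T - (l' - l)) * (T' - T + (l' - l)) by ring.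
  have -> : 4 * D * l' = (2 * D) * (2 * l') by ring.
  have m1 : 0 <= T' - T - (l' - l) by lra. have m2 : 0 <= T' - T + (l' - l) by lra.
  have m3 : T' - T - (l' - l) <= 2 * D by lra.
  have m4 : T' - T + (l' - l) <= 2 * l' by lra.
  exact: ler_pM.
have k2 : l * d (g t) (g' t) ^+ 2 <= 4 * D * t ^+ 2.
  rewrite -(ler_pM2l l0').
  have -> : l' * (l * d (g t) (g' t) ^+ 2) = l * l' * d (g t) (g' t) ^+ 2 by ring.
  apply: (le_trans st).
  have -> : l' * (4 * D * t ^+ 2) = t ^+ 2 * (4 * D * l') by ring.
  by rewrite ler_wpM2l ?sqr_ge0.
have k3 : 4 * D * t ^+ 2 <= l * e ^+ 2 by rewrite -ler_pdivrMr ?exprn_gt0 //; lra.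
rewrite -ler_sqr ?nnegrE ?mdist_ge0 ?(ltW e0) // -(ler_pM2l l0).
exact: le_trans k2 k3.
Qed.

Lemma ray_length gam (p : X) T : is_ray gam -> 0 <= T -> `|d p (gam T) - T| <= d p (gam 0).
Proof.
move=> rg T0; have := dist_abs4 p (gam T) (gam 0) (gam T).
by rewrite mdistxx addr0 (ray_dist rg) // subr0.
Qed.

Definition segs_to (gam : R -> X) (p : X) (c : R -> X) :=
  forall t e, 0 <= t -> 0 < e ->
  exists2 T0, t + d p (gam 0) <= T0 & forall T g, T0 <= T -> seg p (gam T) g ->
    d (g t) (c t) <= e.

Lemma closed_dist_ball (p : X) r : closed [set x | d p x <= r].
Proof.
rewrite -[X in closed X]setCK; apply: open_closedC; rewrite openE => x /= /negP.
rewrite -ltNge => rx; apply/nbhs_ballP; exists (d p x - r); first by rewrite /= subr_gt0.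
move=> y; rewrite ballEmdist /= => xy; apply/negP; rewrite -ltNge.
have := metric_triangle p y x; rewrite (metric_sym y x); lra.
Qed.

Lemma compact_dist_ball (p : X) r : compact [set x | d p x <= r].
Proof.
apply: prop; first exact: closed_dist_ball.
by exists p, (r + 1) => x /= px; rewrite ballEmdist /=; lra.
Qed.

(** Properness provides a cluster point, which is the limit by
    [seg_cauchy]. *)
Lemma segs_limit gam p : is_ray gam -> exists c, segs_to gam p c.
Proof.
move=> rg.
have [g Hg] := choice (fun T => seg_exists p (gam T)).
have lim1 t : exists x, 0 <= t -> forall e, 0 < e ->
   exists2 T0, t + d p (gam 0) <= T0 & forall T h, T0 <= T -> seg p (gam T) h ->
    d (h t) x <= e.
  have [t0|tn] := leP 0 t; last by exists p => h; exfalso; lra.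
  pose N0 := Num.Def.archi_bound (t + d p (gam 0)).
  have HN0 : t + d p (gam 0) < N0%:R.
    by apply: archi_boundP; rewrite addr_ge0 ?mdist_ge0.
  pose u n := g (n + N0)%N%:R t.
  have [n|x _ clx] := compact_seq_cluster (u := u) (@compact_dist_ball p t).
    have TN : N0%:R <= (n + N0)%N%:R :> R by rewrite ler_nat leq_addl.
    have [gg g0 _] := Hg (n + N0)%N%:R.
    have T0 : 0 <= (n + N0)%N%:R :> R by [].
    have := ray_length p rg T0; rewrite ler_norml => /andP[h1 h2].
    rewrite /= /u -{1}g0 (geodesic_dist gg) ?subr0 //; lra.
  exists x => _ e e0; have [T0 hT0 HT0] := seg_cauchy p rg t0 (divr_gt0 e0 (ltr0Sn _ 1)).
  exists T0 => // T h TT sh.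
  have [n nn dn] := clx (e / 2) (Num.Def.archi_bound T0) (divr_gt0 e0 (ltr0Sn _ 1)).
  apply: (le_trans (metric_triangle _ (u n) _)).
  rewrite [e]splitr; apply: lerD; last by rewrite metric_sym ltW.
  apply: (HT0 _ _ _ _ TT _ sh (Hg _)).
  have T00 : 0 <= T0 by rewrite (le_trans _ hT0) ?addr_ge0 ?mdist_ge0.
  apply: (le_trans (ltW (archi_boundP T00))); rewrite ler_nat.
  exact: leq_trans nn (leq_addr _ _).
have [c Hc] := choice lim1; exists c => t e t0 e0; exact: Hc.
Qed.

Lemma segs_to_ray gam p c : is_ray gam -> segs_to gam p c ->
  [/\ is_ray c, c 0 = p & asymptotic gam c].
Proof.
move=> rg Hc.
have near s t e : 0 <= s -> 0 <= t -> 0 < e -> exists T g,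
   [/\ s <= d p (gam T), t <= d p (gam T), t + 1 <= T, 0 <= T & seg p (gam T) g] /\
   (d (g s) (c s) <= e /\ d (g t) (c t) <= e).
  move=> s0 t0 e0; have [T1 h1 H1] := Hc s e s0 e0; have [T2 h2 H2] := Hc t e t0 e0.
  pose T := Num.max T1 (T2 + 1).
  have m1 : T1 <= T by rewrite /T le_max lexx.
  have m2 : T2 + 1 <= T by rewrite /T le_max lexx orbT.
  have [g sg] := seg_exists p (gam T); exists T, g.
  have D0 := mdist_ge0 p (gam 0).
  have T0 : 0 <= T by lra.
  have := ray_length p rg T0; rewrite ler_norml => /andP[k1 k2].
  have m3 : T2 <= T by lra.
  split; first by split => //; lra.
  by split; [exact: (H1 T g m1 sg)|exact: (H2 T g m3 sg)].
split.
- move=> s t; rewrite /= !in_itv /= !andbT => s0 t0.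
  apply/eqP; rewrite -subr_eq0 -normr_le0; apply: le_eps => e e0.
  have e20 : 0 < e / 2 by lra.
  have [T [g [[sT tT _ _ [gg _ _]] [ds dt]]]] := near s t (e / 2) s0 t0 e20.
  rewrite -(gg s t) /= ?in_itv /= ?s0 ?t0 //.
  apply: (le_trans (dist_abs4 _ _ _ _)); rewrite !(metric_sym (c _)); lra.
- apply: mdist_positivity; apply: le_anti; rewrite mdist_ge0 andbT.
  apply: le_eps => e e0; have [T [g [[_ _ _ _ [_ g0 _]] [d0 _]]]] := near 0 0 e (lexx 0) (lexx 0) e0.
  by rewrite add0r -g0 metric_sym.
- exists (2 * d p (gam 0) + 1) => t t0.
  have [T [g [[_ tT Tt T0 [gg g0 g1]] [_ dt]]]] := near t t 1 t0 t0 ltr01.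
  have Tp : 0 < T by lra.
  set D := d p (gam 0); set l := d p (gam T) in gg g1 tT.
  have lamI : 0 <= t / T <= 1 by rewrite divr_ge0 //= ler_pdivrMr // mul1r; lra.
  have [la0 la1] := andP lamI.
  have l0 : 0 <= l by apply: mdist_ge0.
  have := convex_pair l0 T0 gg (ray_geodesic rg) lamI.
  rewrite g0 g1 mdistxx mulr0 addr0 divfK ?gt_eqF // -/D => h1.
  have ll : t / T * l <= l by rewrite ler_piMl.
  have := gg (t / T * l) t; rewrite /= !in_itv /= t0 tT ll mulr_ge0 // => /(_ isT isT) h2.
  have h3 : `|t / T * l - t| <= D.
    have -> : t / T * l - t = t / T * (l - T) by field; rewrite gt_eqF.
    rewrite normrM ger0_norm // (le_trans (y := `|l - T|)) ?ler_piMl //.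
    exact: ray_length.
  have h4 : (1 - t / T) * D <= D by rewrite ler_piMl ?mdist_ge0 //; lra.
  have := metric_triangle (gam t) (g (t / T * l)) (c t).
  have := metric_triangle (g (t / T * l)) (g t) (c t).
  rewrite (metric_sym (gam t) (g _)); lra.
Qed.

Lemma ray_unique c c' : is_ray (X := X) c -> is_ray (X := X) c' -> c 0 = c' 0 ->
  asymptotic c c' -> forall t, 0 <= t -> c t = c' t.
Proof.
move=> rc rc' c0 [K HK] t t0; apply: mdist_positivity; apply: le_anti.
rewrite mdist_ge0 andbT; apply: (le_trans (asymptotic_contract rc rc' HK t0)).
by rewrite c0 mdistxx.
Qed.

Lemma asymptotic_sym c c' : asymptotic (X := X) c c' -> asymptotic c' c.
Proof. by move=> [K H]; exists K => t t0; rewrite metric_sym H. Qed.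

Lemma asymptotic_trans c c' c'' :
  asymptotic (X := X) c c' -> asymptotic c' c'' -> asymptotic c c''.
Proof.
move=> [K H] [K' H']; exists (K + K') => t t0.
by apply: (le_trans (metric_triangle _ (c' t) _)); apply: lerD; [exact: H|exact: H'].
Qed.

Definition flow (gam : R -> X) (p : X) : R -> X := ray_from p (ray_class gam).

(** The rays chosen in the definition of angles at infinity are the limits of
    segments constructed above, because a ray is determined by its origin and
    its end. *)
Lemma flowP gam p : is_ray gam ->
  [/\ is_ray (flow gam p), flow gam p 0 = p, asymptotic gam (flow gam p) &
      segs_to gam p (flow gam p)].
Proof.
move=> rg; have [c Hc] := segs_limit p rg.
have [rc c0 ac] := segs_to_ray rg Hc.
have : (ray_class gam (flow gam p)) /\ flow gam p 0 = p.
  by apply: (@xgetPex _ _ [set c | ray_class gam c /\ c 0 = p]); exists c.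
move=> [[rf af] f0]; split => // t e t0 e0.
rewrite (ray_unique rf rc _ (asymptotic_trans (asymptotic_sym af) ac)) ?f0 ?c0 //.
exact: Hc.
Qed.
(** * Busemann functions *)

Lemma le_epsM (C x y : R) : 0 < C -> (forall e, 0 < e -> e <= 1 -> x <= y + e * C) -> x <= y.
Proof.
move=> C0 H; apply: le_eps => e e0.
pose e' := Num.min 1 (e / C).
have e'0 : 0 < e' by rewrite /e' lt_min ltr01 divr_gt0.
have e'1 : e' <= 1 by rewrite /e' ge_min lexx.
apply: (le_trans (H e' e'0 e'1)); rewrite lerD2l -ler_pdivlMr //.
by rewrite /e' ge_min lexx orbT.
Qed.

(** By the triangle inequality d(x, gam T) - T is nonincreasing in T and
    bounded below, so that the limit exists and is an infimum. *)
Lemma busemann_approx gam (x : X) e : is_ray gam -> 0 < e ->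
  exists2 T0, 0 <= T0 & forall T, T0 <= T ->
    busemann gam x <= d x (gam T) - T <= busemann gam x + e.
Proof.
move=> rg e0; pose f T := d x (gam T) - T.
have fdec s t : 0 <= s -> s <= t -> f t <= f s.
  move=> s0 st; have := metric_triangle x (gam s) (gam t).
  by rewrite (ray_dist rg) // /f; lra.
pose A := [set f T | T in [set T | 0 <= T]].
have Ai : has_inf A.
  split; first by exists (f 0), 0 => //=.
  exists (- d x (gam 0)) => _ [T /= T0 <-].
  by have := ray_length x rg T0; rewrite ler_norml => /andP[]; rewrite /f; lra.
have fge T : 0 <= T -> inf A <= f T by move=> T0; apply: (ge_inf (proj2 Ai)); exists T.
have fle r : 0 < r -> exists2 T0, 0 <= T0 & forall T, T0 <= T -> f T <= inf A + r.
  move=> r0; have [_ [T0 /= T00 <-] fT0] := inf_adherent r0 Ai.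
  exists T0 => // T TT; apply: (le_trans (fdec T0 T T00 TT)); exact: ltW.
have fcvg : f T @[T --> +oo] --> inf A.
  apply/cvgrPdist_le => r r0; have [T0 T00 HT0] := fle r r0.
  exists T0; split; first exact: num_real.
  move=> T /ltW TT; rewrite distrC ger0_norm; first by rewrite lerBlDl HT0.
  by rewrite subr_ge0 fge // (le_trans T00).
have -> : busemann gam x = inf A by apply: cvg_lim.
have [T0 T00 HT0] := fle e e0; exists T0 => // T TT.
by rewrite fge ?HT0 // (le_trans T00).
Qed.

Lemma busemann_lip gam (x y : X) : is_ray gam ->
  busemann gam x - busemann gam y <= d x y.
Proof.
move=> rg; apply: le_eps => e e0.
have [T1 _ H1] := busemann_approx x rg e0; have [T2 _ H2] := busemann_approx y rg e0.
pose T := Num.max T1 T2.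
have m1 : T1 <= T by rewrite /T le_max lexx.
have m2 : T2 <= T by rewrite /T le_max lexx orbT.
have /andP[h1 h2] := H1 T m1; have /andP[h3 h4] := H2 T m2.
have := metric_triangle x y (gam T); lra.
Qed.

Lemma busemann_dist gam (x y : X) : is_ray gam ->
  `|busemann gam x - busemann gam y| <= d x y.
Proof.
move=> rg; have := busemann_lip x y rg; have := busemann_lip y x rg.
by rewrite (metric_sym y x) ler_norml => h1 h2; apply/andP; split; lra.
Qed.

Lemma flow_ray gam p : is_ray gam -> is_ray (flow gam p).
Proof. by move=> /(flowP p) []. Qed.

Lemma flow0 gam p : is_ray gam -> flow gam p 0 = p.
Proof. by move=> /(flowP p) []. Qed.

Lemma flow_asymptotic gam p : is_ray gam -> asymptotic gam (flow gam p).
Proof. by move=> /(flowP p) []. Qed.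

Lemma flow_step gam p s t : is_ray gam -> 0 <= s -> 0 <= t ->
  d (flow gam p s) (flow gam p t) = `|s - t|.
Proof.
by move=> rg s0 t0; apply: (flow_ray p rg); rewrite /= in_itv /= andbT.
Qed.

Lemma flow_dist gam p t : is_ray gam -> 0 <= t -> d p (flow gam p t) = t.
Proof.
move=> rg t0; rewrite -{1}(flow0 p rg) flow_step //.
by rewrite sub0r normrN ger0_norm.
Qed.

Lemma flow_contract gam p q t : is_ray gam -> 0 <= t ->
  d (flow gam p t) (flow gam q t) <= d p q.
Proof.
move=> rg t0; have [K HK] := asymptotic_trans
  (asymptotic_sym (flow_asymptotic p rg)) (flow_asymptotic q rg).
have := asymptotic_contract (flow_ray p rg) (flow_ray q rg) HK t0.
by rewrite !flow0.
Qed.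

Lemma flow_approx gam p t e : is_ray gam -> 0 <= t -> 0 < e ->
  exists2 T0, 0 <= T0 & forall T, T0 <= T ->
   [/\ t <= d p (gam T), busemann gam p <= d p (gam T) - T <= busemann gam p + e &
    exists2 g, seg p (gam T) g & d (g t) (flow gam p t) <= e].
Proof.
move=> rg t0 e0; have [_ _ _ /(_ t e t0 e0) [T1 h1 H1]] := flowP p rg.
have [T2 h2 H2] := busemann_approx p rg e0.
have D0 := mdist_ge0 p (gam 0).
exists (T1 + T2); first lra.
move=> T TT; have [g sg] := seg_exists p (gam T).
have T1T : T1 <= T by lra. have T2T : T2 <= T by lra. have T0 : 0 <= T by lra.
split; [|exact: H2|by exists g; [exact: sg|exact: (H1 T g T1T sg)]].
by have := ray_length p rg T0; rewrite ler_norml => /andP[]; lra.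
Qed.

Lemma busemann_flow gam p t : is_ray gam -> 0 <= t ->
  busemann gam (flow gam p t) = busemann gam p - t.
Proof.
move=> rg t0; apply: le_anti; apply/andP; split; last first.
  by have := busemann_lip p (flow gam p t) rg; rewrite flow_dist //; lra.
apply: (@le_epsM 2) => // e e0 _.
have [T1 h1 H1] := flow_approx p rg t0 e0.
have [T2 h2 H2] := busemann_approx (flow gam p t) rg e0.
have m1 : T1 <= T1 + T2 by lra.
have m2 : T2 <= T1 + T2 by lra.
have [tl /andP[h3 h4] [g [gg g0 g1] hg]] := H1 _ m1.
have /andP[h5 h6] := H2 _ m2.
have := metric_triangle (flow gam p t) (g t) (gam (T1 + T2)).
rewrite -{2}g1 (geodesic_dist gg) // (metric_sym _ (g t)); lra.
Qed.

(** The limit of [cat0_stewart] for the segments from q to gam T as T tends to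
    infinity. This inequality replaces the first variation formula for the
    distance to y. *)
Lemma busemann_stewart gam (y q : X) t : is_ray gam -> 0 <= t ->
  d y (flow gam q t) ^+ 2 <=
  d y q ^+ 2 + 2 * t * (busemann gam y - busemann gam q) + t ^+ 2.
Proof.
move=> rg t0; set A := d y q; set be := _ - _; set D := d y _.
have A0 : 0 <= A by apply: mdist_ge0.
have D0 : 0 <= D by apply: mdist_ge0.
apply: (@le_epsM (2 * t + 2 * (A + t) + 1 + 1)); first lra.
move=> e e0 e1.
have [T1 h1 H1] := flow_approx q rg t0 e0.
have [T2 h2 H2] := busemann_approx y rg e0.
(* A segment longer than M makes the term t (be + e)^2 / l of Stewart's
   inequality smaller than e. *)
pose M := t * (`|be| + 1) ^+ 2 / e.
have M0 : 0 <= M by rewrite divr_ge0 ?mulr_ge0 ?sqr_ge0 // ltW.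
pose T := T1 + T2 + M + `|busemann gam q| + 1.
have nq := normr_ge0 (busemann gam q).
have m1 : T1 <= T by rewrite /T; lra.
have m2 : T2 <= T by rewrite /T; lra.
have [tl /andP[h3 h4] [g [gg g0 g1] hg]] := H1 _ m1.
have /andP[h5 h6] := H2 _ m2.
set l := d q (gam T) in tl h3 h4 gg g1.
have tI : 0 <= t <= l by rewrite t0.
have := cat0_stewart y cat gg tI; rewrite g0 g1 => st.
have lM : M < l.
  have := ler_norm (- busemann gam q); rewrite normrN => h7.
  by move: h3; rewrite /T; lra.
have l0 : 0 < l by lra.
set D' := d y (g t) in st; set B := d y (gam T) in st h5 h6.
have D'0 : 0 <= D' by apply: mdist_ge0.
have B0 : 0 <= B by apply: mdist_ge0.
have Ble : B <= l + (be + e) by rewrite /be; lra.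
have B2 : B ^+ 2 <= (l + (be + e)) ^+ 2 by rewrite ler_sqr ?nnegrE //; lra.
have be2 : t * (be + e) ^+ 2 <= e * l.
  apply: (@le_trans _ _ (e * M)); last by rewrite ler_pM2l // ltW.
  have -> : e * M = t * (`|be| + 1) ^+ 2 by rewrite /M mulrC divfK ?gt_eqF.
  apply: ler_wpM2l => //; rewrite -[leLHS]real_normK ?num_real //.
  rewrite ler_sqr ?nnegrE ?addr_ge0 //.
  apply: (le_trans (ler_normD _ _)); rewrite lerD2l ger0_norm // ltW //.
have D'2 : D' ^+ 2 <= A ^+ 2 + 2 * t * (be + e) + t ^+ 2 + e.
  rewrite -(ler_pM2l l0); apply: (le_trans st).
  have := ler_wpM2l t0 B2.
  have : 0 <= t * A ^+ 2 by rewrite mulr_ge0 ?sqr_ge0.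
  rewrite -/A; move: be2; rewrite -subr_ge0 => k1 k2.
  rewrite -subr_ge0 => k3; rewrite -subr_ge0.
  apply: (le_trans (addr_ge0 (addr_ge0 k1 k2) k3)).
  by rewrite le_eqVlt; apply/orP; left; apply/eqP; ring.
have D'A : D' <= A + t.
  apply: (le_trans (metric_triangle y q _)); rewrite -/A lerD2l -{1}g0.
  by rewrite (geodesic_dist gg) // subr0.
have DD' : D <= D' + e by apply: (le_trans (metric_triangle y (g t) _)); rewrite lerD2l.
have : D ^+ 2 <= (D' + e) ^+ 2 by rewrite ler_sqr ?nnegrE //; lra.
have k1 : 0 <= e * (A + t - D') by apply: mulr_ge0; lra.
have k2 : 0 <= e * (1 - e) by apply: mulr_ge0; lra.
have k3 : 0 <= e * t by rewrite mulr_ge0 //; lra.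
move=> /le_trans; apply; rewrite -subr_ge0.
rewrite -subr_ge0 in D'2.
apply: (le_trans (addr_ge0 D'2 (addr_ge0 (mulr_ge0 (ler0n _ 2) k1) k2))).
by rewrite le_eqVlt; apply/orP; left; apply/eqP; ring.
Qed.

Lemma busemann_convex gam c l t : is_ray gam -> geodesic_on (X := X) `[0, l] c -> 0 <= t <= l ->
  l * busemann gam (c t) <= (l - t) * busemann gam (c 0) + t * busemann gam (c l).
Proof.
move=> rg gc tI; have /andP[t0 tl] := tI.
apply: (@le_epsM (l + 1)) => [|e e0 _]; first lra.
have [T1 _ H1] := busemann_approx (c 0) rg e0.
have [T2 _ H2] := busemann_approx (c l) rg e0.
have [T3 _ H3] := busemann_approx (c t) rg e0.
pose T := Num.max (Num.max T1 T2) T3.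
have m1 : T1 <= T by rewrite /T !le_max lexx.
have m2 : T2 <= T by rewrite /T !le_max lexx orbT.
have m3 : T3 <= T by rewrite /T !le_max lexx orbT.
have := dist_convex (gam T) gc tI; rewrite !(metric_sym (gam T)).
move: (H1 T m1) (H2 T m2) (H3 T m3) => /andP[a1 a2] /andP[b1 b2] /andP[c1 c2] h.
have l0 : 0 <= l by lra.
have k1 := ler_wpM2l l0 c1.
have lt0 : 0 <= l - t by lra.
have k2 := ler_wpM2l lt0 a2; have k3 := ler_wpM2l t0 b2.
have -> : e * (l + 1) = l * e + e by ring.
lra.
Qed.
(** * Angles and the slopes of Busemann functions *)

Lemma comparison_angle_bounds (p x y : X) : 0 < d p x -> 0 < d p y ->
  0 <= comparison_angle p x y <= pi /\
  d x y ^+ 2 = d p x ^+ 2 + d p y ^+ 2 - 2 * d p x * d p y * cos (comparison_angle p x y).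
Proof.
move=> a0 b0; rewrite /comparison_angle.
have := dist_abs p x y; have := metric_triangle x p y; rewrite (metric_sym x p).
have := mdist_ge0 x y.
move: a0 b0; set a := d p x; set b := d p y; set c := d x y => a0 b0 c0 tr1.
rewrite ler_norml => /andP[tr2 tr3].
have ab0 : 0 < 2 * a * b by rewrite !mulr_gt0.
have k1 : 0 <= (c - (a - b)) * (c + (a - b)) by apply: mulr_ge0; lra.
have k2 : 0 <= (a + b - c) * (a + b + c) by apply: mulr_ge0; lra.
have k3 : - 1 <= (a ^+ 2 + b ^+ 2 - c ^+ 2) / (2 * a * b) <= 1.
  by rewrite ler_pdivlMr // ler_pdivrMr //; apply/andP; split; lra.
have [-> ->] := acos_def k3; split => //.
by rewrite mulrC divfK ?gt_eqF //; ring.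
Qed.

Lemma cos_antitone (x y : R) : 0 <= x -> x <= y -> y <= pi -> cos y <= cos x.
Proof.
move=> x0 xy ypi; have := @ltr_cos R y x; rewrite !in_itv /= x0 ypi.
rewrite (le_trans x0 xy) (le_trans xy ypi) => /(_ isT isT) h.
by rewrite leNgt h -leNgt.
Qed.

Lemma cos_upper (A r : R) : 0 <= A <= pi -> 0 < r ->
  exists2 e, 0 < e & forall th, 0 <= th <= pi -> th <= A + e -> cos A - r <= cos th.
Proof.
move=> /andP[A0 Api] r0; have := @continuous_cos R A => /cvgrPdist_lt /(_ r r0).
move=> [e /= e0 He]; exists (e / 2); first by rewrite divr_gt0.
move=> th /andP[th0 thpi] thA; have [le|lt] := leP th A.
  have := cos_antitone th0 le Api; lra.
have : `|A - th| < e by rewrite ltr_norml; apply/andP; split; lra.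
by move=> /He; rewrite /= ltr_norml => /andP[]; lra.
Qed.

(** The upper limit that defines the angle is finite since comparison angles lie
    in [0, pi]; being an infimum of suprema it is approached from above. *)
Lemma alexandrov_angleP (c c' : R -> X) : is_ray c -> is_ray c' -> c 0 = c' 0 ->
  0 <= alexandrov_angle c c' <= pi /\
  forall e, 0 < e -> exists2 r, 0 < r &
  forall s t, 0 < s < r -> 0 < t < r ->
    comparison_angle (c 0) (c s) (c' t) <= alexandrov_angle c c' + e.
Proof.
move=> rc rc' c0.
pose f (st : R * R) : \bar R := (comparison_angle (c 0) (c st.1) (c' st.2))%:E.
pose F : set_system (R * R) := filter_prod 0^'+ 0^'+.
have fb s t : 0 < s -> 0 < t -> 0 <= comparison_angle (c 0) (c s) (c' t) <= pi.
  move=> s0 t0; have [] // := @comparison_angle_bounds (c 0) (c s) (c' t).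
    by rewrite (ray_dist rc) ?subr0 // ltW.
  by rewrite c0 (ray_dist rc') ?subr0 // ltW.
have L0 : (0%:E <= limf_esup f F)%E.
  rewrite limf_esupE; apply: le_ereal_inf_tmp => /= _ [V FV <-].
  have : F (V `&` [set st | 0 < st.1 /\ 0 < st.2]).
    apply: filterI => //; exists ([set s | 0 < s], [set s | 0 < s]) => //=.
    by split; exact: nbhs_right_gt.
  move=> /filter_ex [[s t] [Vst [/= s0 t0]]].
  apply: (@le_trans _ _ (f (s, t))).
    by rewrite lee_fin; have /andP[] := fb s t s0 t0.
  by apply: ereal_sup_ubound; exists (s, t).
have Lpi : (limf_esup f F <= pi%:E)%E.
  rewrite limf_esupE; apply: (@le_trans _ _ (ereal_sup (f @` [set st | 0 < st.1 /\ 0 < st.2]))).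
    apply: ereal_inf_lbound; exists [set st | 0 < st.1 /\ 0 < st.2] => //.
    exists ([set s | 0 < s], [set s | 0 < s]) => //=.
    by split; exact: nbhs_right_gt.
  apply: ge_ereal_sup => _ [[s t] [/= s0 t0] <-].
  by rewrite lee_fin; have /andP[] := fb s t s0 t0.
have Lfin : limf_esup f F \is a fin_num.
  by rewrite fin_numElt (lt_le_trans _ L0) ?ltNyr //= (le_lt_trans Lpi) ?ltry.
have LE : limf_esup f F = (alexandrov_angle c c')%:E by rewrite -[LHS]fineK.
split; first by rewrite -!lee_fin -LE L0.
move=> e e0.
have : (limf_esup f F < (alexandrov_angle c c' + e)%:E)%E.
  by rewrite LE lte_fin ltrDl.
rewrite {1}limf_esupE => /ereal_inf_lt [_ [V [[P Q] [/= FP FQ] PQ] <-] ltV].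
have [r1 /= r10 H1] := FP; have [r2 /= r20 H2] := FQ.
exists (Num.min r1 r2); first by rewrite lt_min r10.
move=> s t /andP[s0]; rewrite lt_min => /andP[s1 s2] /andP[t0]; rewrite lt_min => /andP[t1 t2].
have Vst : V (s, t).
  apply: PQ; split => /=; [apply: H1|apply: H2] => //=;
    by rewrite sub0r normrN gtr0_norm.
rewrite -lee_fin; apply: le_trans (ltW ltV).
by apply: ereal_sup_ubound; exists (s, t).
Qed.

(** Compare c t with the point at a fixed time s on the ray from c 0 to the end
    of gam: there the Busemann function has dropped by s, it is 1-Lipschitz, and
    for t much smaller than s the distance between the two points is
    s - t cos A up to a small multiple of t, where A is the angle. *)
Lemma first_variation gam c r : is_ray (X := X) gam -> is_ray c -> 0 < r ->
  exists2 t0, 0 < t0 & forall t, 0 < t < t0 ->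
    busemann gam (c t) - busemann gam (c 0) <=
    (- cos (alexandrov_angle (flow gam (c 0)) c) + r) * t.
Proof.
move=> rg rc r0; set p := c 0; set A := alexandrov_angle _ _.
have rf := flow_ray p rg; have f0 := flow0 p rg.
have [Ab HA] := alexandrov_angleP rf rc f0.
have [e e0 He] := cos_upper Ab (divr_gt0 r0 (ltr0Sn _ 1)).
have [r1 r10 Hr] := HA e e0.
pose s := r1 / 2; have s0 : 0 < s by rewrite divr_gt0.
exists (Num.min (Num.min r1 (s / (2 + r))) (r * s)).
  by rewrite !lt_min r10 divr_gt0 ?mulr_gt0 //; lra.
move=> t /andP[t0]; rewrite !lt_min => /andP[/andP[tr1 ts] trs].
have sI : 0 < s < r1 by rewrite s0 /s; lra.
have tI : 0 < t < r1 by rewrite t0.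
have := Hr s t sI tI; rewrite f0.
have ps : d p (flow gam p s) = s by rewrite flow_dist // ltW.
have pt : d p (c t) = t by rewrite (ray_dist rc) ?subr0 // ltW.
have ps0 : 0 < d p (flow gam p s) by rewrite ps.
have pt0 : 0 < d p (c t) by rewrite pt.
have [] := comparison_angle_bounds ps0 pt0; rewrite ps pt.
set th := comparison_angle _ _ _ => thb dE thA.
have cth := He th thb thA; rewrite -/A in cth.
set D := d _ _ in dE; set C := cos A in cth *.
have D0 : 0 <= D by apply: mdist_ge0.
have C1 := cos_le1 A; have C2 := cos_geN1 A; rewrite -/C in C1 C2.
pose u := t * (- C + r / 2) + t ^+ 2 / (2 * s).
have tt : t ^+ 2 / (2 * s) <= t * (r / 2).
  rewrite ler_pdivrMr ?mulr_gt0 //.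
  have -> : t * (r / 2) * (2 * s) = t * (r * s) by field.
  by rewrite expr2 ler_pM2l // ltW.
have tt0 : 0 <= t ^+ 2 / (2 * s) by rewrite divr_ge0 ?sqr_ge0 // mulr_ge0 // ltW.
have su : 0 <= s + u.
  have : t * (2 + r) < s by rewrite -ltr_pdivlMr //; lra.
  have : 0 <= t * (r + 1 - C + r / 2).
    by apply: mulr_ge0; lra.
  rewrite /u; lra.
have Du : D <= s + u.
  rewrite -ler_sqr ?nnegrE // dE.
  have k1 : 0 <= 2 * s * t * (cos th - (C - r / 2)).
    by apply: mulr_ge0; [rewrite !mulr_ge0 // ltW|lra].
  have k2 := sqr_ge0 u.
  rewrite -subr_ge0; apply: (le_trans (addr_ge0 k1 k2)).
  rewrite le_eqVlt; apply/orP; left; apply/eqP; rewrite /u; field; lra.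
have h1 := busemann_lip (c t) (flow gam p s) rg.
rewrite busemann_flow ?(ltW s0) // (metric_sym (c t)) -/D in h1.
move: Du; rewrite /u; lra.
Qed.

Lemma flow_shift gam p s t : is_ray gam -> 0 <= s -> 0 <= t ->
  flow gam (flow gam p s) t = flow gam p (s + t).
Proof.
move=> rg s0 t0; have rp := flow_ray p rg.
apply: (@ray_unique _ (fun t => flow gam p (s + t)) _ _ _ _ t t0).
- exact: flow_ray.
- move=> a b; rewrite /= !in_itv /= !andbT => a0 b0.
  by rewrite flow_step ?addr_ge0 //; congr (`|_|); ring.
- by rewrite addr0 flow0.
- apply: (asymptotic_trans (asymptotic_sym (flow_asymptotic _ rg))).
  apply: (asymptotic_trans (flow_asymptotic p rg)).
  exists s => u u0; rewrite flow_step ?addr_ge0 //.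
  by rewrite opprD addrCA subrr addr0 normrN ger0_norm.
Qed.

Lemma angle_bounds gam zet p : is_ray gam -> is_ray zet ->
  [/\ 0 <= alexandrov_angle (flow gam p) (flow zet p),
      alexandrov_angle (flow gam p) (flow zet p) <= angle (ray_class gam) (ray_class zet) &
      angle (ray_class gam) (ray_class zet) <= pi].
Proof.
move=> rg rz.
have ab q : 0 <= alexandrov_angle (flow gam q) (flow zet q) <= pi.
  by have [] := alexandrov_angleP (flow_ray q rg) (flow_ray q rz);
     rewrite ?flow0.
have /andP[p0 ppi] := ab p.
pose S := [set angle_at q (ray_class gam) (ray_class zet) | q in setT].
have Sne : S !=set0 by exists (angle_at p (ray_class gam) (ray_class zet)), p.
have Sub : ubound S pi by move=> _ [q _ <-]; have /andP[] := ab q.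
split => //.
  by apply: ub_le_sup; [exists pi|exists p].
by apply: ge_sup.
Qed.

(** By convexity the mean slope on [0, T] is at most the right derivative at T,
    which the first variation bounds by the angle at that point; the angle at
    infinity is the supremum of the angles at all points. *)
Lemma busemann_slope gam zet p T : is_ray gam -> is_ray zet -> 0 <= T ->
  busemann gam (flow zet p T) - busemann gam p <=
  - cos (angle (ray_class gam) (ray_class zet)) * T.
Proof.
move=> rg rz T0.
have [A0 Ale Api] := angle_bounds (flow zet p T) rg rz.
have cle := cos_antitone A0 Ale Api.
set y := flow zet p T in A0 Ale cle *; set A := alexandrov_angle _ _ in A0 Ale cle.
apply: (@le_trans _ _ (- cos A * T)); last by apply: ler_wpM2r => //; lra.
apply: (@le_epsM (T + 1)) => [|r r0 _]; first lra.
have [t0 t00 Ht] := first_variation rg (flow_ray y rz) r0.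
pose t := t0 / 2; have t_0 : 0 < t by rewrite divr_gt0.
have tI : 0 < t < t0 by rewrite t_0 /t; lra.
have := Ht t tI; rewrite flow0 // -/A flow_shift // ?(ltW t_0) // => h1.
have TI : 0 <= T <= T + t by rewrite T0 lerDl ltW.
have := busemann_convex rg (ray_geodesic (flow_ray p rz)) TI.
rewrite flow0 // -/y addrAC subrr add0r => h2.
have h3 := ler_wpM2l T0 h1.
rewrite -(ler_pM2l t_0).
have := mulr_ge0 (ltW t_0) (ltW r0).
lra.
Qed.
Lemma cos_lip (x y : R) : x <= y -> cos x - cos y <= y - x.
Proof.
move=> xy; have [|z _] := @MVT_segment R cos (- sin) x y xy.
  exact/continuous_subspaceT/continuous_cos.
rewrite -[cos y - cos x]opprB => h.
have -> : cos x - cos y = sin z * (y - x) by rewrite -[LHS]opprK h mulNr opprK.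
by apply: ler_piMl; [lra|exact: sin_le1].
Qed.

Lemma cos_opposite (a b del : R) : 0 <= a <= pi -> 0 <= b <= pi -> 0 < del ->
  a + b < pi + del -> - cos a - cos b <= del.
Proof.
move=> /andP[a0 api] /andP[b0 bpi] d0 ab.
have cb : cos (pi - b) = - cos b by rewrite addrC cosDpi cosN.
have [le|lt] := leP a (pi - b).
  have bb : pi - b <= pi by lra.
  by have := cos_antitone a0 le bb; rewrite cb; lra.
have := cos_lip (ltW lt); rewrite cb; lra.
Qed.

Lemma cos_acute (a del : R) : 0 <= a <= pi -> 0 < del ->
  a < pi / 2 + del -> - cos a <= del.
Proof.
move=> /andP[a0 api] d0 ad; have [le|lt] := leP a (pi / 2).
  have pi2 : pi / 2 <= pi :> R by have := pi_ge0 R; lra.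
  by have := cos_antitone a0 le pi2; rewrite cos_pihalf; lra.
have := cos_lip (ltW lt); rewrite cos_pihalf; lra.
Qed.

Lemma alexandrov_angle_sym (c c' : R -> X) : c 0 = c' 0 ->
  alexandrov_angle c c' = alexandrov_angle c' c.
Proof.
move=> c0; rewrite /alexandrov_angle !limf_esupE; congr (fine (ereal_inf _)).
have sw (P : set (R * R)) : filter_prod 0^'+ 0^'+ P ->
    filter_prod 0^'+ 0^'+ [set st | P (st.2, st.1)].
  move=> [[A B] [/= FA FB] AB]; exists (B, A) => //= -[s t] [/= Bs At].
  by apply: AB.
have cs s t : comparison_angle (c 0) (c s) (c' t) = comparison_angle (c' 0) (c' t) (c s).
  rewrite /comparison_angle c0 (metric_sym (c s)); congr (acos (_ / _)); ring.
apply/seteqP; split => [_ [V FV <-]|_ [V FV <-]];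
  exists [set st | V (st.2, st.1)]; try exact: sw;
  congr ereal_sup; apply/seteqP; split => [_ [[s t] /= Vst <-]|_ [[s t] /= Vst <-]];
  by exists (t, s) => //=; rewrite cs.
Qed.

Lemma angle_sym (gam zet : R -> X) : is_ray gam -> is_ray zet ->
  angle (ray_class gam) (ray_class zet) = angle (ray_class zet) (ray_class gam).
Proof.
move=> rg rz; congr sup; apply/seteqP; split => _ [p _ <-]; exists p => //;
  by apply: alexandrov_angle_sym; rewrite -?/(flow _ _) !flow0.
Qed.

(** * Asymptotic slopes *)

Lemma le0_archi (T0 C u : R) : (forall T, T0 <= T -> T * u <= C) -> u <= 0.
Proof.
move=> H; rewrite leNgt; apply/negP => u0.
have := H (`|T0| + (`|C| + 1) / u); rewrite (le_trans (ler_norm T0)); last first.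
  by rewrite lerDl divr_ge0 // ?addr_ge0 // ltW.
move=> /(_ isT); rewrite mulrDl divfK ?gt_eqF //.
have := mulr_ge0 (normr_ge0 T0) (ltW u0); have := ler_norm C; lra.
Qed.

(** Along a ray a convex function grows at most with its asymptotic slope, and
    this slope is the same for all rays with the same end. *)
Lemma slope_transfer (gam zet : R -> X) x0 K m : is_ray gam -> is_ray zet ->
  (forall T, 0 <= T -> busemann gam (flow zet x0 T) <= K + m * T) ->
  forall q t, 0 <= t -> busemann gam (flow zet q t) <= busemann gam q + m * t.
Proof.
move=> rg rz HK q t t0; rewrite -subr_le0.
apply: (@le0_archi t (t * (K + d q x0 - busemann gam q))) => T tT.
have T0 : 0 <= T by exact: le_trans tT.
have tI : 0 <= t <= T by rewrite t0.
have := busemann_convex rg (ray_geodesic (flow_ray q rz)) tI.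
rewrite flow0 // => h1.
have h2 := busemann_lip (flow zet q T) (flow zet x0 T) rg.
have h3 := flow_contract q x0 rz T0.
have h4 := HK T T0.
have h5 : busemann gam (flow zet q T) <= K + m * T + d q x0 by lra.
have := ler_wpM2l t0 h5; lra.
Qed.

Lemma flow_self (zet : R -> X) T : is_ray zet -> 0 <= T -> flow zet (zet 0) T = zet T.
Proof.
move=> rz T0; apply: (ray_unique (flow_ray _ rz) rz) => //; first exact: flow0.
exact/asymptotic_sym/flow_asymptotic.
Qed.

(** The slope of the first Busemann function along rays to the second end
    bounds the slope of the second one along rays to the first end, as both are
    governed by the angle between the ends. The proof applies
    [busemann_stewart] to far points y of zet: the difference of squares divided
    by 2 T tends to a difference of values of the Busemann function of zet. *)
Lemma slope_symmetric (gam zet : R -> X) m : is_ray gam -> is_ray zet ->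
  (forall q t, 0 <= t -> busemann gam (flow zet q t) <= busemann gam q + m * t) ->
  forall q t, 0 <= t -> busemann zet (flow gam q t) <= busemann zet q + m * t.
Proof.
move=> rg rz Hm q t t0; apply: le_eps => e e0; rewrite -subr_le0.
set q' := flow gam q t.
have [T1 T10 H1] := busemann_approx q rz e0.
have [T2 T20 H2] := busemann_approx q' rz e0.
pose C1 := d q (zet 0) + d q' (zet 0).
pose K := busemann gam (zet 0) - busemann gam q.
apply: (@le0_archi (T1 + T2) (t * K + t ^+ 2 / 2 + t * C1 / 2)) => T TT.
have T_0 : 0 <= T by lra.
have TT1 : T1 <= T by lra. have TT2 : T2 <= T by lra.
have /andP[a1 a2] := H1 T TT1; have /andP[b1 b2] := H2 T TT2.
have h1 : busemann gam (zet T) <= busemann gam (zet 0) + m * T.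
  by rewrite -[zet T](flow_self rz T_0); exact: Hm.
have := busemann_stewart (zet T) q rg t0; rewrite -/q' !(metric_sym (zet T)).
have := ray_length q rz T_0; have := ray_length q' rz T_0.
have := dist_abs (zet T) q' q; rewrite (metric_sym q' q) flow_dist //.
rewrite !(metric_sym (zet T)) !ler_norml.
set A := d q' (zet T) in b1 b2 *; set B := d q (zet T) in a1 a2 *.
move=> /andP[c1 c2] /andP[d1 d2] /andP[f1 f2] st.
have k1 : - (t * C1) <= (A - B) * (A + B - 2 * T).
  have : `|(A - B) * (A + B - 2 * T)| <= t * C1.
    rewrite normrM; apply: ler_pM => //; rewrite ler_norml; apply/andP; split; rewrite /C1; lra.
  by rewrite ler_norml => /andP[].
have k2 : 0 <= 2 * t * (busemann gam (zet 0) + m * T - busemann gam (zet T)).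
  by apply: mulr_ge0; lra.
have k3 : 0 <= T * (A - B + e - (busemann zet q' - busemann zet q)).
  by apply: mulr_ge0; lra.
have k4 : A ^+ 2 - B ^+ 2 = 2 * (T * (A - B)) + (A - B) * (A + B - 2 * T) by ring.
rewrite /K; lra.
Qed.

Hypothesis gcX : geodesically_complete X.

Lemma ray_through x y : exists2 zet, is_ray zet & flow zet x (d x y) = y.
Proof.
have [g [gg g0 g1]] := seg_exists x y.
have [c' /(local_geodesicE) gc' cg] := gcX (mdist_ge0 x y) gg.
have rc : is_ray c' by exact: geodesic_sub gc'.
exists c' => //; rewrite -{1}[x]g0 -(cg 0) ?in_itv /= ?lexx ?mdist_ge0 //.
rewrite flow_self ?mdist_ge0 // cg ?g1 //.
by rewrite in_itv /= mdist_ge0 lexx.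
Qed.

(** Extend the segment from x to y to a ray with end zet: the two slopes along
    it are at most - cos a and - cos b for angles with a + b < pi + del. *)
Lemma opposite_lipschitz (gam eta : R -> X) del : is_ray gam -> is_ray eta -> 0 < del ->
  opposite_spherical del (ray_class gam) (ray_class eta) ->
  forall x y, (busemann gam y + busemann eta y) - (busemann gam x + busemann eta x) <=
    del * d x y.
Proof.
move=> rg re d0 opp x y; have [zet rz <-] := ray_through x y.
set D := d x y; have D0 : 0 <= D by exact: mdist_ge0.
rewrite flow_dist //.
have := opp (ray_class zet); rewrite (angle_sym rz re) => /(_ _) h.
have {}h := h (ex_intro2 _ _ zet rz erefl).
have [a1 a2 a3] := angle_bounds x rg rz; have [b1 b2 b3] := angle_bounds x re rz.
have := busemann_slope x rg rz D0; have := busemann_slope x re rz D0.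
move: a3 b3 h (le_trans a1 a2) (le_trans b1 b2).
set a := angle _ _; set b := angle _ _ => a3 b3 h a0 b0 h1 h2.
have aI : 0 <= a <= pi by apply/andP.
have bI : 0 <= b <= pi by apply/andP.
rewrite opprD addrACA; apply: (le_trans (lerD h2 h1)).
by rewrite -mulrDl ler_wpM2r // cos_opposite.
Qed.

Lemma acute_slope (gam zet : R -> X) del : is_ray gam -> is_ray zet -> 0 < del ->
  angle (ray_class gam) (ray_class zet) < pi / 2 + del ->
  forall q t, 0 <= t -> busemann gam (flow zet q t) - busemann gam q <= del * t.
Proof.
move=> rg rz d0 h q t t0; apply: (le_trans (busemann_slope q rg rz t0)).
apply: ler_wpM2r => //; have [a1 a2 a3] := angle_bounds q rg rz.
by apply: cos_acute => //; rewrite a3 (le_trans a1).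
Qed.
Lemma flow_lip (gam : R -> X) q q' t t' : is_ray gam -> 0 <= t -> 0 <= t' ->
  d (flow gam q t) (flow gam q' t') <= d q q' + `|t - t'|.
Proof.
move=> rg t0 t0'; apply: (le_trans (metric_triangle _ (flow gam q' t) _)).
by rewrite flow_step // lerD2r flow_contract.
Qed.

(** Convexity only bounds the slope of the first Busemann function up to the
    time D. Beyond D the convexity of the opposite one bounds it, since their
    sum is almost constant. *)
Lemma line_slope (gam eta zet : R -> X) del x D al :
  is_ray gam -> is_ray eta -> is_ray zet -> 0 < del ->
  (forall x y, (busemann gam y + busemann eta y) - (busemann gam x + busemann eta x)
     <= del * d x y) ->
  0 < D -> busemann gam (flow zet x D) - busemann gam x = al * D ->
  forall T, 0 <= T -> busemann gam (flow zet x T) <= busemann gam x + (al + 2 * del) * T.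
Proof.
move=> rg re rz del0 fg D0 hal T T0; have gz l := ray_geodesic (l := l) (flow_ray x rz).
have dT := mulr_ge0 (ltW del0) T0.
have [TD|DT] := leP T D.
  have TI : 0 <= T <= D by rewrite T0.
  have := busemann_convex rg (gz D) TI; rewrite flow0 // => h.
  have h2 : D * busemann gam (flow zet x T) <= D * (busemann gam x + al * T).
    apply: (le_trans h); rewrite le_eqVlt; apply/orP; left; apply/eqP.
    have -> : busemann gam (flow zet x D) = busemann gam x + al * D by rewrite -hal; ring.
    by ring.
  by rewrite ler_pM2l // in h2; lra.
have DI : 0 <= D <= T by rewrite !ltW.
have := busemann_convex re (gz T) DI; rewrite flow0 // => h.
have h1 := fg (flow zet x D) x; have h2 := fg x (flow zet x T).
rewrite (metric_sym (flow _ _ _)) !flow_dist ?(ltW D0) // in h1 h2.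
rewrite -(ler_pM2l D0).
have k1 := ler_wpM2l T0 h1; have k2 := ler_wpM2l (ltW D0) h2.
have e1 : T * (busemann gam (flow zet x D) - busemann gam x) = T * (al * D) by rewrite hal.
lra.
Qed.

(** A lower bound from an upper one: after a walk to gam and then one of the
    same length to eta the distance to the starting point is at most
    (2 del)^(1/2) t. So, up to this distance, the first walk cannot lower the
    Busemann function of zet by more than the second one can raise it. *)
Lemma move_back (gam eta zet : R -> X) del m q t :
  is_ray gam -> is_ray eta -> is_ray zet -> 0 < del ->
  (forall x y, (busemann gam y + busemann eta y) - (busemann gam x + busemann eta x)
     <= del * d x y) ->
  (forall q t, 0 <= t -> busemann zet (flow eta q t) <= busemann zet q + m * t) ->
  0 <= t ->
  busemann zet q - (m + Num.sqrt (2 * del)) * t <= busemann zet (flow gam q t).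
Proof.
move=> rg re rz del0 fg hm t0; set q' := flow gam q t; set q'' := flow eta q' t.
have hq' : d q q' = t by rewrite flow_dist.
have : d q q'' <= Num.sqrt (2 * del) * t.
  rewrite -ler_sqr ?nnegrE ?mdist_ge0 ?mulr_ge0 ?sqrtr_ge0 //.
  rewrite exprMn sqr_sqrtr; last by rewrite mulr_ge0 // ltW.
  apply: (le_trans (busemann_stewart q q' re t0)); rewrite hq'.
  have := fg q' q; rewrite (metric_sym q') hq' busemann_flow // => h.
  have := ler_wpM2l t0 h; lra.
have := hm q' t t0; rewrite -/q''; have := busemann_lip q q'' rz; lra.
Qed.

(** * Strainers at infinity *)

Section Strainer.
Variables (n : nat) (gam eta : 'I_n -> R -> X) (del : R).
Hypothesis rg : forall j, is_ray (gam j).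
Hypothesis re : forall j, is_ray (eta j).
Hypothesis del0 : 0 < del.
Hypothesis opp : forall j, opposite_spherical del (ray_class (gam j)) (ray_class (eta j)).
Hypothesis acute : forall j k, j != k ->
  [/\ angle (ray_class (gam j)) (ray_class (gam k)) < pi / 2 + del,
      angle (ray_class (eta j)) (ray_class (eta k)) < pi / 2 + del &
      angle (ray_class (gam j)) (ray_class (eta k)) < pi / 2 + del].

Let f j := busemann (gam j).
Let g j := busemann (eta j).
Let P j := flow (gam j).
Let Q j := flow (eta j).

Lemma strainer_fg j x y : (f j y + g j y) - (f j x + g j x) <= del * d x y.
Proof. exact: opposite_lipschitz. Qed.

Lemma strainer_gf j x y : (g j y + f j y) - (g j x + f j x) <= del * d x y.
Proof. by rewrite ![g j _ + _]addrC; exact: strainer_fg. Qed.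

Lemma strainer_P_off j k q t : j != k -> 0 <= t ->
  f k (P j q t) - f k q <= del * t /\ g k (P j q t) - g k q <= del * t.
Proof.
move=> jk t0; have [_ _ h1] := acute jk; rewrite eq_sym in jk.
have [h2 _ _] := acute jk.
split; first exact: (acute_slope (rg k) (rg j) del0 h2).
by apply: (acute_slope (re k) (rg j) del0 _ _ t0); rewrite angle_sym.
Qed.

Lemma strainer_Q_off j k q t : j != k -> 0 <= t ->
  f k (Q j q t) - f k q <= del * t /\ g k (Q j q t) - g k q <= del * t.
Proof.
rewrite eq_sym => jk t0; have [_ h1 h2] := acute jk.
split; first exact: (acute_slope (rg k) (re j) del0 h2).
exact: (acute_slope (re k) (re j) del0 h1).
Qed.

Lemma strainer_upper x y :
  \sum_j (f j x - f j y) ^+ 2 <= (1 + 2 * del * n%:R * (3 * n%:R + 1)) * d x y ^+ 2.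
Proof.
exact: (coords_upper del0 (fun j q t => flow_dist q (rg j))
  (fun j q t => flow_dist q (re j)) (fun j q t => busemann_flow q (rg j))
  (fun j q t => busemann_flow q (re j))
  (fun j y q t => busemann_stewart y q (rg j))
  (fun j y q t => busemann_stewart y q (re j))
  strainer_fg strainer_P_off strainer_Q_off
  (fun j x y => busemann_dist x y (rg j))).
Qed.

Lemma strainer_improve (z : 'I_n -> R) x : exists q,
  \sum_j `|f j q - z j| <= 2 * del * n%:R * \sum_j `|f j x - z j|.
Proof.
exact: (coords_improve del0 (fun j q t => flow_dist q (rg j))
  (fun j q t => flow_dist q (re j)) (fun j q t => busemann_flow q (rg j))
  (fun j q t => busemann_flow q (re j))
  strainer_fg strainer_P_off strainer_Q_off).
Qed.

(** Points violating this inequality would give n + 1 independent flows: those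
    to the ends of the strainer and that to the end of a ray from x through
    y. *)
Lemma strainer_lower ka x y : has_refinements X n.+1 -> 0 < ka ->
  (4 * del + Num.sqrt (2 * del)) * n.+2%:R / ka * n.+1%:R <= 1 / 4 ->
  (1 - ka) * d x y ^+ 2 <= \sum_j (f j x - f j y) ^+ 2.
Proof.
move=> dimX ka0 small; rewrite leNgt; apply/negP => lt.
have D0 : 0 < d x y.
  rewrite mdist_gt0; apply/eqP => xy; move: lt; rewrite xy mdistxx expr0n mulr0.
  by rewrite ltNge sumr_ge0 // => j _; exact: sqr_ge0.
set D := d x y in lt D0.
have [zet rz hz] := ray_through x y; rewrite -/D in hz.
pose al j := (f j y - f j x) / D.
pose be j := (g j y - g j x) / D.
have alD j : al j * D = f j y - f j x by rewrite divfK // gt_eqF.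
have beD j : be j * D = g j y - g j x by rewrite divfK // gt_eqF.
have beal j : be j <= - al j + del.
  rewrite -(ler_pM2r D0) mulrDl mulNr alD beD.
  have := strainer_fg j x y; rewrite -/D; lra.
have f_slope j q t (t0 : 0 <= t) : f j (flow zet q t) <= f j q + (al j + 2 * del) * t.
  apply: (slope_transfer (rg j) rz (x0 := x) (K := f j x)) => // T T0.
  apply: (line_slope (rg j) (re j) rz del0 (strainer_fg j) D0) => //.
  by rewrite hz alD.
have g_slope j q t (t0 : 0 <= t) : g j (flow zet q t) <= g j q + (be j + 2 * del) * t.
  apply: (slope_transfer (re j) rz (x0 := x) (K := g j x)) => // T T0.
  apply: (line_slope (re j) (rg j) rz del0 (strainer_gf j) D0) => //.
  by rewrite hz beD.
have hP_slope j q t (t0 : 0 <= t) :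
    busemann zet (P j q t) <= busemann zet q + (al j + 2 * del) * t.
  exact: (slope_symmetric (rg j) rz (f_slope j)).
have hQ_slope j q t (t0 : 0 <= t) :
    busemann zet (Q j q t) <= busemann zet q + (be j + 2 * del) * t.
  exact: (slope_symmetric (re j) rz (g_slope j)).
set sg := 4 * del + _ in small.
have sq0 : 0 <= Num.sqrt (2 * del) by apply: sqrtr_ge0.
have sg0 : 0 <= sg by have := del0; rewrite /sg; lra.
apply: (@dimension_bound R X compact_dist_ball n f (busemann zet) P (flow zet)
  al sg ka x) => //.
- by move=> j a b; exact: busemann_dist.
- by move=> a b; exact: busemann_dist.
- by move=> j q t t0; exact: flow_dist.
- by move=> q t t0; exact: flow_dist.
- by move=> *; exact: flow_lip.
- by move=> *; exact: flow_lip.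
- move=> j k q t t0; have [->|kj] := eqVneq k j.
    have e0 b : b - t - b + t = 0 :> R by ring.
    by rewrite /f /P busemann_flow // [true%:R * _]mul1r e0 normr0 mulr_ge0.
  have jk : j != k by rewrite eq_sym.
  have [h1 h2] := strainer_P_off q jk t0.
  have h3 := strainer_fg k (P j q t) q; rewrite metric_sym flow_dist // in h3.
  have dt := mulr_ge0 (ltW del0) t0; have st := mulr_ge0 sq0 t0.
  by rewrite mul0r addr0 /sg ler_norml; apply/andP; split; lra.
- move=> j q t t0; have h1 := f_slope j q t t0; have h2 := g_slope j q t t0.
  have h3 := strainer_fg j (flow zet q t) q; rewrite metric_sym flow_dist // in h3.
  have k1 := ler_wpM2r t0 (beal j).
  have dt := mulr_ge0 (ltW del0) t0; have st := mulr_ge0 sq0 t0.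
  by rewrite /sg ler_norml; apply/andP; split; lra.
- move=> j q t t0; have h1 := hP_slope j q t t0.
  have h2 := move_back q (rg j) (re j) rz del0 (strainer_fg j) (hQ_slope j) t0.
  have k1 := ler_wpM2r t0 (beal j).
  have dt := mulr_ge0 (ltW del0) t0; have st := mulr_ge0 sq0 t0.
  by rewrite /sg ler_norml; apply/andP; split; rewrite /P; lra.
- by move=> q t t0; exact: busemann_flow.
- have -> : \sum_j al j ^+ 2 = (\sum_j (f j x - f j y) ^+ 2) / D ^+ 2.
    rewrite mulr_suml; apply: eq_bigr => j _.
    by rewrite /al expr_div_n -(opprB (f j x)) sqrrN.
  have : (\sum_j (f j x - f j y) ^+ 2) / D ^+ 2 <= 1 - ka.
    by rewrite ler_pdivrMr ?exprn_gt0 // ltW.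
  lra.
Qed.

End Strainer.
End Cat0.
(** * Strainer maps are bi-Lipschitz homeomorphisms *)

Lemma eucl_dist_le (R : realType) (n : nat) (u v : 'rV[R]_n) r : 0 <= r ->
  (forall j, `|u ord0 j - v ord0 j| <= r) -> eucl_dist u v <= n%:R * r.
Proof.
move=> r0 H; have nr0 : 0 <= n%:R * r by rewrite mulr_ge0.
rewrite -[leRHS]ger0_norm // -sqrtr_sqr ler_wsqrtr //.
apply: (@le_trans _ _ (\sum_(j < n) r ^+ 2)).
  apply: ler_sum => j _; rewrite -[leLHS]real_normK ?num_real //.
  by rewrite ler_sqr ?nnegrE.
rewrite sumr_const card_ord exprMn -[leLHS]mulr_natl ler_wpM2r ?sqr_ge0 //.
by rewrite -natrX ler_nat; case: (n) => // m; rewrite -mulnn leq_pmull.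
Qed.

(** The empty cover refines every cover of the empty space. *)
Lemma covering_dim_nonempty (X : topologicalType) n : covering_dim X n -> exists x : X, True.
Proof.
move=> [_ nref]; apply: contrapT => noX; apply: nref => U _ _.
have noP (x : X) : False by apply: noX; exists x.
exists set0; split => //.
by split => //; rewrite -subTset => x; case: (noP x).
Qed.

(** The lower Lipschitz bound gives injectivity and the continuity of the
    inverse. *)
Lemma bilipschitz_continuous_inverse (R : realType) (X : metricType R) n
    (F : X -> 'rV[R]_n) c : 0 < c ->
  bilipschitz (@mdist R X) (@eucl_dist R n) c F -> (forall z, exists q, F q = z) ->
  (forall j, continuous (fun x => F x ord0 j)) ->
  homeomorphism F.
Proof.
move=> c0 bl surj Fc; have [G GK] := choice surj.
exists G; split => //.
- move=> x; apply/cvg_ballP => e e0.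
  have : \forall y \near x, forall j : 'I_n, `|F x ord0 j - F y ord0 j| < e.
    by apply: filter_forall => j; exact: (cvgrPdist_lt _ _).1 (Fc j x) e e0.
  apply: filterS => y Hy; split => // i j.
  by rewrite (ord1 i); exact: Hy.
- move=> z A /nbhs_ballP [e /= e0 eA].
  pose r := e / (2 * c * n.+1%:R).
  have den0 : 0 < 2 * c * n.+1%:R by rewrite !mulr_gt0.
  have r0 : 0 < r by rewrite divr_gt0.
  rewrite /= -[nbhs (_ @ _) _]/(nbhs z (G @^-1` A)).
  apply/nbhs_ballP; exists r => // w [_ zw]; apply: eA; rewrite ballEmdist /=.
  have [_ h] := bl (G z) (G w); rewrite !GK in h.
  apply: (le_lt_trans h); apply: (@le_lt_trans _ _ (c * (n%:R * r))).
    rewrite ler_pM2l //; apply: eucl_dist_le; first exact: ltW.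
    by move=> j; exact/ltW/(zw ord0 j).
  have : c * (n%:R * r) <= c * (n.+1%:R * r).
    by rewrite ler_pM2l // ler_pM2r // ler_nat.
  move=> /le_lt_trans; apply.
  have -> : c * (n.+1%:R * r) = e / 2.
    by rewrite /r; field; rewrite gt_eqF //= gt_eqF.
  by rewrite ltr_pdivrMr //; lra.
- move=> x; apply: mdist_positivity; apply: le_anti; rewrite mdist_ge0 andbT.
  have [_ h] := bl (G (F x)) x; rewrite GK eucl_distxx mulr0 in h; exact: h.
Qed.

Lemma delta_choice (R : realType) (eps : R) (n : nat) : 0 < eps < 1 ->
  let ka := 1 - (1 + eps) ^- 2 in
  exists2 del : R, 0 < del &
   [/\ 0 < ka, 1 + 2 * del * n%:R * (3 * n%:R + 1) <= (1 + eps) ^+ 2,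
       2 * del * n%:R < 1 &
       (4 * del + Num.sqrt (2 * del)) * n.+2%:R / ka * n.+1%:R <= 1 / 4].
Proof.
move=> /andP[e0 e1] ka.
have c1 : 1 < (1 + eps) ^+ 2 by rewrite -[X in X < _](expr1n _ 2) ltr_sqr ?nnegrE; lra.
have ka0 : 0 < ka by rewrite subr_gt0 invf_lt1 //; lra.
have ka1 : ka < 1 by rewrite /ka ltrBlDr ltrDl invr_gt0; lra.
pose m : R := n%:R; have m0 : 0 <= m by [].
have n1 : n.+1%:R = m + 1 :> R by rewrite -addn1 natrD.
have n2 : n.+2%:R = m + 2 :> R by rewrite -addn2 natrD.
rewrite -/m n1 n2.
pose M := (m + 1) * (m + 2).
have mm : 0 <= m * m by rewrite mulr_ge0.
have M0 : 0 < M by rewrite /M; lra.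
(* The square root in the last condition suggests to take for delta the square
   of w; then 4 w^2 + (2 w^2)^(1/2) <= 6 w, which leads to the constant 24. *)
pose w := ka * eps / (24 * M).
have wM : w * (24 * M) = ka * eps by rewrite divfK // gt_eqF //; lra.
have w0 : 0 < w by rewrite /w !mulr_gt0 ?invr_gt0 //; lra.
have ke : ka * eps < 1 by rewrite -[X in _ < X]mulr1; apply: ltr_pM => //; exact: ltW.
have ke2 : ka * eps <= eps by rewrite ler_piMl; lra.
have wm : w * M <= 1 / 24 by lra.
have M1 : 1 <= M by rewrite /M; lra.
have wmm : 0 <= w * (m * m) by rewrite mulr_ge0 // ltW.
have wm0 : 0 <= w * m by rewrite mulr_ge0 // ltW.
have wME : w * M = w * (m * m) + 3 * (w * m) + 2 * w by rewrite /M; ring.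
have w1 : w <= 1 by lra.
have ww : w ^+ 2 <= w by rewrite expr2 ler_piMl // ltW.
exists (w ^+ 2); first by rewrite exprn_gt0.
have k1 : w ^+ 2 * (m * m) <= w * (m * m) by rewrite ler_wpM2r.
have k2 : w ^+ 2 * m <= w * m by rewrite ler_wpM2r.
split => //.
- have -> : 1 + 2 * w ^+ 2 * m * (3 * m + 1) = 1 + 6 * (w ^+ 2 * (m * m)) + 2 * (w ^+ 2 * m) by ring.
  have h1 : 24 * (w * M) <= eps by lra.
  have -> : (1 + eps) ^+ 2 = 1 + 2 * eps + eps ^+ 2 by ring.
  have := sqr_ge0 eps; lra.
- lra.
- have sq : Num.sqrt (2 * w ^+ 2) <= 2 * w.
    have w2 : 0 <= 2 * w by lra.
    have le2 : 2 * w ^+ 2 <= (2 * w) ^+ 2.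
      have -> : (2 * w) ^+ 2 = 4 * w ^+ 2 by ring.
      have := sqr_ge0 w; lra.
    by have := ler_wsqrtr le2; rewrite sqrtr_sqr ger0_norm.
  have -> : (4 * w ^+ 2 + Num.sqrt (2 * w ^+ 2)) * (m + 2) / ka * (m + 1) =
    (4 * w ^+ 2 + Num.sqrt (2 * w ^+ 2)) * M / ka by rewrite /M; ring.
  rewrite ler_pdivrMr //; apply: (@le_trans _ _ (6 * w * M)).
    by rewrite ler_pM2r //; lra.
  have -> : 6 * w * M = (ka * eps) / 4 by rewrite -wM; field.
  have := mulr_ge0 (ltW ka0) (ltW e0); have : ka * eps <= ka * 1 by rewrite ler_pM2l // ltW.
  lra.
Qed.

Theorem proposition5p10 (R : realType) (N : nat) (hN : (0 < N)%N)
    (eps : R) (heps : 0 < eps < 1) (n : nat) (hn : (0 < n)%N) :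
  exists2 delta : R, 0 < delta &
    forall (X : metricType R) (F : X -> 'rV[R]_n),
      doubling X N -> proper_space X -> geodesically_complete X -> cat0 X ->
      covering_dim X n ->
      busemann_strainer_map delta F ->
      bilipschitz (@mdist R X) (@eucl_dist R n) (1 + eps) F /\
      homeomorphism F.
Proof.
have [del del0 [ka0 up small1 small2]] := delta_choice n heps.
have /andP[eps0 _] := heps.
exists del => // X F _ prop gc cat dimX [gam [rg [_ [eta0 [bd opp0 ac0]]] FE]].
have bd' j : exists e, is_ray e /\ ray_class e = eta0 j.
  by have [e re <-] := bd j; exists e.
have [eta Heta] := choice bd'.
have re j : is_ray (eta j) by have [] := Heta j.
have etaE j : ray_class (eta j) = eta0 j by have [] := Heta j.
have opp j : opposite_spherical del (ray_class (gam j)) (ray_class (eta j)).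
  by rewrite etaE; exact: opp0.
have ac j k : j != k ->
  [/\ angle (ray_class (gam j)) (ray_class (gam k)) < pi / 2 + del,
      angle (ray_class (eta j)) (ray_class (eta k)) < pi / 2 + del &
      angle (ray_class (gam j)) (ray_class (eta k)) < pi / 2 + del].
  by rewrite !etaE; exact: ac0.
have c0 : 0 < 1 + eps by lra.
have Fj x j : F x ord0 j = busemann (gam j) x by rewrite FE mxE.
have FD x y : eucl_dist (F x) (F y) =
    Num.sqrt (\sum_j (busemann (gam j) x - busemann (gam j) y) ^+ 2).
  by congr Num.sqrt; apply: eq_bigr => j _; rewrite !Fj.
have bl : bilipschitz (@mdist R X) (@eucl_dist R n) (1 + eps) F.
  move=> x y; rewrite FD; split.
    rewrite -[leRHS]ger0_norm; last by rewrite mulr_ge0 ?mdist_ge0 // ltW.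
    rewrite -sqrtr_sqr ler_wsqrtr // exprMn.
    apply: (le_trans (strainer_upper cat prop gc rg re del0 opp ac x y)).
    by rewrite ler_wpM2r ?sqr_ge0.
  have := strainer_lower cat prop gc rg re del0 opp ac x y dimX.1 ka0 small2.
  rewrite subKr => low.
  rewrite -ler_sqr ?nnegrE ?mdist_ge0 ?mulr_ge0 ?sqrtr_ge0 ?(ltW c0) //.
  rewrite exprMn sqr_sqrtr; last by apply: sumr_ge0 => j _; exact: sqr_ge0.
  by rewrite -ler_pdivrMl ?exprn_gt0.
have Lip j x y : `|F x ord0 j - F y ord0 j| <= 1 * mdist x y.
  by rewrite mul1r !Fj; exact: busemann_dist.
split => //; apply: (bilipschitz_continuous_inverse c0 bl); last first.
  by move=> j; exact: (lipschitz_continuous (Lip j)).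
move=> z; have [x0 _] := covering_dim_nonempty dimX.
pose Phi q := \sum_j `|F q ord0 j - z ord0 j|.
have Phi0 q : 0 <= Phi q by apply: sumr_ge0.
have Phij q j : `|F q ord0 j - z ord0 j| <= Phi q.
  by rewrite /Phi (bigD1 j) //= lerDl; apply: sumr_ge0.
(* The lower Lipschitz bound confines the points with error at most that of x0
   to this ball. *)
pose r := (1 + eps) * (n%:R * (2 * Phi x0)).
have r0 : 0 <= r by rewrite /r !mulr_ge0 // ltW.
pose A := [set q | mdist x0 q <= r].
have inA q : Phi q <= Phi x0 -> A q.
  move=> hq; apply: (le_trans (bl x0 q).2); rewrite ler_pM2l //.
  apply: eucl_dist_le => [|j]; first by rewrite mulr_ge0.
  have -> : F x0 ord0 j - F q ord0 j =
    (F x0 ord0 j - z ord0 j) - (F q ord0 j - z ord0 j) by ring.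
  apply: (le_trans (ler_normB _ _)).
  have := Phij x0 j; have := Phij q j; lra.
have PhiC : continuous Phi.
  apply: (@lipschitz_continuous _ _ _ n%:R) => x y.
  rewrite /Phi -sumrB; apply: (le_trans (ler_norm_sum _ _ _)).
  apply: (@le_trans _ _ (\sum_(j < n) mdist x y)); last first.
    by rewrite sumr_const card_ord mulr_natl.
  apply: ler_sum => j _; apply: (le_trans (ler_dist_dist _ _)).
  have -> : F x ord0 j - z ord0 j - (F y ord0 j - z ord0 j) = F x ord0 j - F y ord0 j.
    by ring.
  by have := Lip j x y; rewrite mul1r.
have [|q0 _ qmin] := @compact_EVT_min _ _ Phi A _ (compact_dist_ball prop (p := x0) (r := r))
   (continuous_subspaceT PhiC).
  by exists x0; apply: inA.
have q0x : Phi q0 <= Phi x0 by apply: qmin; rewrite inE; exact: inA.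
have [q1 hq1] := strainer_improve cat prop gc rg re del0 opp ac (fun j => z ord0 j) q0.
have {}hq1 : Phi q1 <= 2 * del * n%:R * Phi q0.
  rewrite /Phi; under eq_bigr => j _ do rewrite Fj.
  by under [X in _ <= _ * X]eq_bigr => j _ do rewrite Fj.
have q01 : Phi q0 <= Phi q1.
  apply: qmin; rewrite inE; apply: inA; apply: (le_trans hq1).
  by apply: le_trans q0x; apply: ler_piMl => //; exact: ltW.
have Phi00 : Phi q0 = 0.
  apply: le_anti; rewrite Phi0 andbT.
  have : (1 - 2 * del * n%:R) * Phi q0 <= 0 by lra.
  by rewrite pmulr_rle0 // subr_gt0.
exists q0; apply/rowP => j; apply/eqP; rewrite -subr_eq0 -normr_le0.
by rewrite -Phi00; exact: Phij.
Qed.
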